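(* Let $0<\alpha_1\le\alpha_2\le\dots\le\alpha_n\le1$ and $\boldsymbol\alpha=(\alpha_1,\dots,\alpha_n)$. A function $f:\mathcal{S}_2^n\to\mathbf{R}\cup\{\infty\}$ is $\boldsymbol\alpha$-bisubmodular if and only if $f$ is submodular on the modular semilattice $\mathcal{S}_2^n$ with respect to the valuation $v_{\boldsymbol\alpha}$.
   Context: $\mathcal{S}_2=\{-,0,+\}$ with minimum $0$ and incomparable $-,+$; $\mathcal{S}_2^n$ has the componentwise order. Operations on $\mathcal{S}_2$, extended componentwise: $x\wedge y=x$ if $x=y$, else $0$; $x\sqcup y$ is the larger of $x,y$ if comparable and $0$ if $\{x,y\}=\{-,+\}$; $x\sqcup_+y=+$ if $\{x,y\}=\{-,+\}$ and $x\sqcup y$ otherwise. For $i=0,\dots,n$, $\sqcup^i$ applies $\sqcup_+$ in the first $i$ coordinates and $\sqcup$ in the others. With $\alpha_0:=0$, $\alpha_{n+1}:=1$, $f$ is $\boldsymbol\alpha$-bisubmodular if $f(p)+f(q)\ge f(p\wedge q)+\sum_{i=0}^n(\alpha_{i+1}-\alpha_i)f(p\sqcup^iq)$ for all $p,q$. Valuation: $v_i(0)=0$, $v_i(+)=1$, $v_i(-)=\alpha_i$, and $v_{\boldsymbol\alpha}(x)=\sum_iv_i(x_i)$. Submodularity w.r.t. $v=v_{\boldsymbol\alpha}$: for $p,q$ let $I(p,q)$ be the elements on shortest $p$–$q$ paths of the covering graph of $\mathcal{S}_2^n$; $v(u;p,q)=(v(u\wedge p)-v(p\wedge q),v(u\wedge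 q)-v(p\wedge q))$; $\mathcal{E}(p,q)$ the $u\in I(p,q)$ with $v(u;p,q)$ a componentwise-maximal extreme point of the convex hull $\mathrm{Conv}I(p,q)$ of these vectors; $C(u;p,q)=\{w\in\mathbf{R}^2_{\ge0}:\langle w,v(u;p,q)\rangle=\max_{z\in\mathrm{Conv}I(p,q)}\langle w,z\rangle\}=\{(x,y)\ge0:y\cos\alpha\le x\sin\alpha,\ y\cos\beta\ge x\sin\beta\}$ ($0\le\beta\le\alpha\le\pi/2$), $[C]=\frac{\sin\alpha}{\sin\alpha+\cos\alpha}-\frac{\sin\beta}{\sin\beta+\cos\beta}$. $f$ is submodular w.r.t. $v$ if $f(p)+f(q)\ge f(p\wedge q)+\sum_{u\in\mathcal{E}(p,q)}[C(u;p,q)]f(u)$ for all $p,q$ (zero-coefficient terms omitted; $a+\infty=\infty$). *)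

(* Defs.v *)
From HB Require Import structures.
From mathcomp Require Import all_boot all_order all_algebra.
From mathcomp Require Import mathcomp_extra boolp classical_sets reals ereal.
From mathcomp Require Import trigo.
Set Implicit Arguments. Unset Strict Implicit. Unset Printing Implicit Defensive.
Import Order.TTheory GRing.Theory Num.Theory.
Local Open Scope ring_scope.

Inductive S2 := Mn | Z0 | Pl.

Definition S2_to_nat (x : S2) : nat := match x with Mn => 0 | Z0 => 1 | Pl => 2 end.
Definition nat_to_S2 (k : nat) : S2 := match k with 0 => Mn | 1 => Z0 | _ => Pl end.
Lemma S2_natK : cancel S2_to_nat nat_to_S2. Proof. by case. Qed.
HB.instance Definition _ := Countable.copy S2 (can_type S2_natK).
Definition S2_enum := [:: Mn; Z0; Pl].
Lemma S2_enumP : Finite.axiom S2_enum. Proof. by case. Qed.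
HB.instance Definition _ := isFinite.Build S2 S2_enumP.

Definition S2n (n : nat) := {ffun 'I_n -> S2}.

Definition s2le (x y : S2) : bool := (x == Z0) || (x == y).
Definition s2meet (x y : S2) : S2 := if x == y then x else Z0.
Definition s2join (x y : S2) : S2 :=
  if s2le x y then y else if s2le y x then x else Z0.
Definition s2joinp (x y : S2) : S2 :=
  if ((x == Mn) && (y == Pl)) || ((x == Pl) && (y == Mn)) then Pl else s2join x y.

Section Ops.
Variable n : nat.
Implicit Types p q u w z : S2n n.

Definition sle p q : bool := [forall i, s2le (p i) (q i)].
Definition slt p q : bool := (p != q) && sle p q.
Definition smeet p q : S2n n := [ffun i => s2meet (p i) (q i)].
Definition sjoin_i (i : nat) p q : S2n n :=
  [ffun j : 'I_n => if (j < i)%N then s2joinp (p j) (q j) else s2join (p j) (q j)].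

Definition covers w u : bool := slt w u && [forall z, ~~ (slt w z && slt z u)].
Definition cadj u w : bool := covers u w || covers w u.

Definition Ipq p q (u : S2n n) : Prop :=
  exists s : seq (S2n n),
    [/\ path cadj p s, last p s = q, u \in p :: s &
        forall s' : seq (S2n n), path cadj p s' -> last p s' = q ->
          (size s <= size s')%N].
End Ops.

Section Real.
Variable R : realType.
Variable n : nat.
Implicit Types p q u : S2n n.

(* alpha_0 := 0, alpha_1..alpha_n := a 0 .. a (n-1), alpha_{n+1} := 1 *)
Definition alpha_ext (a : 'I_n -> R) (k : nat) : R :=
  if k is k'.+1 then (if insub k' is Some j then a j else 1) else 0.

Definition vcoord (a : 'I_n -> R) (j : 'I_n) (x : S2) : R :=
  match x with Z0 => 0 | Pl => 1 | Mn => a j end.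
Definition valpha (a : 'I_n -> R) p : R := \sum_(j < n) vcoord a j (p j).

Local Open Scope ereal_scope.

Definition alpha_bisubmodular (a : 'I_n -> R) (f : S2n n -> \bar R) : Prop :=
  forall p q,
    f (smeet p q) + \sum_(i < n.+1)
        ((alpha_ext a i.+1 - alpha_ext a i)%R%:E * f (sjoin_i i p q))
    <= f p + f q.

Local Close Scope ereal_scope.

Definition vpt (a : 'I_n -> R) u p q : R * R :=
  (valpha a (smeet u p) - valpha a (smeet p q),
   valpha a (smeet u q) - valpha a (smeet p q)).

Definition convI (a : 'I_n -> R) p q : set (R * R) :=
  [set z | exists lam : S2n n -> R,
     [/\ (forall u, 0 <= lam u), (forall u, ~ Ipq p q u -> lam u = 0),
         \sum_u lam u = 1,
         z.1 = \sum_u lam u * (vpt a u p q).1 &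
         z.2 = \sum_u lam u * (vpt a u p q).2]].

Definition extreme_point (K : set (R * R)) (x : R * R) : Prop :=
  K x /\ forall y z (t : R), K y -> K z -> 0 < t < 1 ->
    x.1 = t * y.1 + (1 - t) * z.1 -> x.2 = t * y.2 + (1 - t) * z.2 ->
    y = x /\ z = x.

Definition cw_maximal (K : set (R * R)) (x : R * R) : Prop :=
  K x /\ ~ exists y, [/\ K y, x.1 <= y.1, x.2 <= y.2 & y <> x].

Definition Epq (a : 'I_n -> R) p q u : Prop :=
  [/\ Ipq p q u, extreme_point (convI a p q) (vpt a u p q) &
      cw_maximal (convI a p q) (vpt a u p q)].

Definition Cone (a : 'I_n -> R) u p q : set (R * R) :=
  [set w | [/\ 0 <= w.1, 0 <= w.2 &
     forall z, convI a p q z ->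
       w.1 * z.1 + w.2 * z.2 <= w.1 * (vpt a u p q).1 + w.2 * (vpt a u p q).2]].

Definition angle_cone (al be : R) : set (R * R) :=
  [set w | [/\ 0 <= w.1, 0 <= w.2, w.2 * cos al <= w.1 * sin al &
              w.1 * sin be <= w.2 * cos be]].

Definition angles_of (C : set (R * R)) (ab : R * R) : Prop :=
  [/\ 0 <= ab.2, ab.2 <= ab.1, ab.1 <= pi / 2 & C = angle_cone ab.1 ab.2].

(* [C] := sin al/(sin al + cos al) - sin be/(sin be + cos be); 0 if C is not of
   the above form (never happens for the cones used below). *)
Definition cone_measure (C : set (R * R)) : R :=
  match pselect (exists ab, angles_of C ab) with
  | left H => let ab := projT1 (cid H) in
      sin ab.1 / (sin ab.1 + cos ab.1) - sin ab.2 / (sin ab.2 + cos ab.2)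
  | right _ => 0
  end.

Local Open Scope ereal_scope.

Definition submodular_wrt (a : 'I_n -> R) (f : S2n n -> \bar R) : Prop :=
  forall p q,
    f (smeet p q) + \sum_(u | `[< Epq a p q u >])
        ((cone_measure (Cone a u p q))%:E * f u)
    <= f p + f q.

End Real.

(* Main.v *)
Require Import Defs.
From HB Require Import structures.
From mathcomp Require Import all_boot all_order all_algebra.
From mathcomp Require Import mathcomp_extra boolp classical_sets reals ereal.
From mathcomp Require Import trigo zify ring lra.
Import Order.TTheory GRing.Theory Num.Theory.
Local Open Scope ring_scope.
Set Implicit Arguments. Unset Strict Implicit. Unset Printing Implicit Defensive.

(* Write al_0 = 0 <= al_1 <= ... <= al_(n+1) = 1, d_i = al_(i+1) - al_i,
   s_i = al_i / (1 + al_i) and c_i = s_(i+1) - s_i.  Maximizing a direction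
   (1 - s, s) over Conv I(p,q) decouples over the coordinates: a coordinate with
   {p_j, q_j} = {-,+} switches from p_j to q_j when s passes s_j (if p_j = -) or
   1 - s_j (if p_j = +).  Hence submodularity with respect to v reads
     f(p) + f(q) >= f(p /\ q) + sum_i c_i (f(u_i) + f(u'_i)),
   where u_i, u'_i have + in every conflicting coordinate of index <= i, and
   agree with p, resp. q, in the other conflicting coordinates.  Both notions give
   f(p) + f(q) >= f(p /\ q) + f(p \/ q) on pairs without conflict, which reduces
   everything to pairs whose coordinates are equal or opposite.

   Submodular => bisubmodular: the pair (u_i, u'_i) has meet w_i, the i-th join of
   p and q, and uncrossing it yields the pairs (u_k, u'_k), k >= i; solving the
   resulting triangular system of inequalities from the top gives the claim.

   Bisubmodular => submodular: with x_i = u_i /\ q and y_i = u_i /\ p one has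
   f(u_i) + f(p /\ q) <= f(x_i) + f(y_i); applying bisubmodularity to (p, u_i)
   bounds f(y_i) by f(p) and the f(x_k), and averaging with the weights c_i leaves
   only sum_i d_i (f(x_i) + f(x'_i)) <= f(p) + f(q), where x'_i = u'_i /\ p.  This
   follows from the pairs (p, u'_k) and (q, u'_k) for the last k with d_k > 0. *)


Definition opp_signs (x y : S2) : bool :=
  ((x == Mn) && (y == Pl)) || ((x == Pl) && (y == Mn)).

(* The elements [u_i] of [I(p,q)] maximizing the directions below the diagonal
   are the [ujoin i p q]; those above the diagonal are the [ujoin i q p]. *)
Definition ujoin {n} (i : nat) (p q : S2n n) : S2n n :=
  sjoin_i i p (sjoin_i i p q).

Definition compat {n} (p q : S2n n) := forall j, ~~ opp_signs (p j) (q j).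

Definition full_pair {n} (p q : S2n n) :=
  forall j, (p j == q j) || opp_signs (p j) (q j).


(** * Coordinatewise identities for meets and joins *)

Section Identities.
Variable n : nat.
Implicit Types (p q u : S2n n) (i k l : nat).

Lemma smeetC p q : smeet p q = smeet q p.
Proof. by apply/ffunP=> j; rewrite !ffunE; case: (p j); case: (q j). Qed.

Lemma sjoin_iC i p q : sjoin_i i p q = sjoin_i i q p.
Proof.
by apply/ffunP=> j; rewrite !ffunE; case: (p j); case: (q j); case: (j < i)%N.
Qed.

Lemma ujoinE i p q j : ujoin i p q j =
  if opp_signs (p j) (q j) then (if (j < i)%N then Pl else p j)
  else s2join (p j) (q j).
Proof. by rewrite !ffunE; case: (j < i)%N; case: (p j); case: (q j). Qed.

Lemma compat_sjoin i p q : compat p q -> sjoin_i i p q = sjoin_i 0 p q.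
Proof.
move=> pq; apply/ffunP=> j; rewrite !ffunE ltn0; case: ifP => // _.
by move: (pq j); case: (p j); case: (q j).
Qed.

Lemma compat_ujoin i p q : compat p q -> ujoin i p q = sjoin_i 0 p q.
Proof.
move=> pq; apply/ffunP=> j; rewrite ujoinE !ffunE ltn0.
by move: (pq j); case: (p j); case: (q j).
Qed.

Lemma full_pair_ujoin i p q : full_pair (ujoin i p q) (ujoin i q p).
Proof. by move=> j; rewrite !ujoinE; case: ltnP; case: (p j); case: (q j). Qed.

Lemma smeet_ujoin i p q : smeet (ujoin i p q) (ujoin i q p) = sjoin_i i p q.
Proof.
apply/ffunP=> j; rewrite ffunE !ujoinE ffunE.
by case: ltnP; case: (p j); case: (q j).
Qed.

(** Only the conflicts at positions [i] and beyond survive the first uncrossing; the second one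
    resolves those below [l]. *)
Lemma ujoin_ujoin i l p q :
  ujoin l (ujoin i p q) (ujoin i q p) = ujoin (maxn i l) p q.
Proof.
apply/ffunP=> j; rewrite !ujoinE leq_max.
by case: (j < i)%N; case: (j < l)%N; case: (p j); case: (q j).
Qed.

Lemma sjoin0_sjoin p q : sjoin_i 0 p (sjoin_i 0 p q) = ujoin 0 p q.
Proof. by []. Qed.

Lemma compat_sjoin0l p q : compat p (sjoin_i 0 p q).
Proof. by move=> j; rewrite ffunE ltn0; case: (p j); case: (q j). Qed.

(** Meeting with the level-0 join erases exactly the conflicting coordinates, so neither the meet
    nor the level-0 join of the pair changes. *)
Lemma compat_smeet_sjoin0 p q :
  compat (smeet p (sjoin_i 0 p q)) (smeet q (sjoin_i 0 p q)).
Proof. by move=> j; rewrite !ffunE ltn0; case: (p j); case: (q j). Qed.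

Lemma smeet_smeet_sjoin0 p q :
  smeet (smeet p (sjoin_i 0 p q)) (smeet q (sjoin_i 0 p q)) = smeet p q.
Proof. by apply/ffunP=> j; rewrite !ffunE ltn0; case: (p j); case: (q j). Qed.

Lemma sjoin_smeet_sjoin0 p q :
  sjoin_i 0 (smeet p (sjoin_i 0 p q)) (smeet q (sjoin_i 0 p q)) = sjoin_i 0 p q.
Proof. by apply/ffunP=> j; rewrite !ffunE ltn0; case: (p j); case: (q j). Qed.

(** For a full pair every coordinate of u_i comes from [p] or from [q], so u_i is the conflict-free
    join of its meets with both; submodularity without conflict then bounds the value at u_i. *)
Lemma compat_parts i p q :
  compat (smeet (ujoin i p q) p) (smeet (ujoin i p q) q).
Proof.
move=> j; rewrite [smeet _ p j]ffunE [smeet _ q j]ffunE ujoinE.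
by case: ltnP; case: (p j); case: (q j).
Qed.

Lemma smeet_parts i p q :
  smeet (smeet (ujoin i p q) p) (smeet (ujoin i p q) q) = smeet p q.
Proof.
apply/ffunP=> j; rewrite [LHS]ffunE [smeet _ p j]ffunE [smeet _ q j]ffunE.
rewrite [RHS]ffunE ujoinE.
by case: ltnP; case: (p j); case: (q j).
Qed.

Lemma sjoin_parts i p q : full_pair p q ->
  sjoin_i 0 (smeet (ujoin i p q) p) (smeet (ujoin i p q) q) = ujoin i p q.
Proof.
move=> pq; apply/ffunP=> j; rewrite [LHS]ffunE ltn0 [smeet _ p j]ffunE.
rewrite [smeet _ q j]ffunE ujoinE.
by move: (pq j); case: ltnP; case: (p j); case: (q j).
Qed.

(** The l-th join of [p] with u_i differs from u_i only where it has lost a + coming from [q], and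
    u_i /\ q supplies that + again. This and the next two facts feed [bisub_split] with v = u_i. *)
Lemma compat_fill i l p q : full_pair p q ->
  compat (smeet (ujoin i p q) q) (sjoin_i l p (ujoin i p q)).
Proof.
move=> pq j; rewrite [smeet _ q j]ffunE [sjoin_i l _ _ j]ffunE ujoinE.
by move: (pq j); case: ltnP; case: (j < l)%N; case: (p j); case: (q j).
Qed.

Lemma sjoin_fill i l p q : full_pair p q ->
  sjoin_i 0 (smeet (ujoin i p q) q) (sjoin_i l p (ujoin i p q)) = ujoin i p q.
Proof.
move=> pq; apply/ffunP=> j; rewrite [LHS]ffunE ltn0 [smeet _ q j]ffunE.
rewrite [sjoin_i l _ _ j]ffunE ujoinE.
by move: (pq j); case: ltnP; case: (j < l)%N; case: (p j); case: (q j).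
Qed.

Lemma smeet_fill i l p q : full_pair p q ->
  smeet (smeet (ujoin i p q) q) (sjoin_i l p (ujoin i p q)) =
  smeet (ujoin (minn l i) p q) q.
Proof.
move=> pq; apply/ffunP=> j; rewrite [LHS]ffunE [RHS]ffunE [smeet _ q j]ffunE.
rewrite [sjoin_i l _ _ j]ffunE !ujoinE leq_min.
by move: (pq j); case: (j < i)%N; case: (j < l)%N; case: (p j); case: (q j).
Qed.

(** The same pattern for v = u'_k. The bound [l <= k] keeps the + signs created by the l-th join
    away from the positions where u'_k still carries a - of [q]. *)
Lemma compat_cross k l p q : full_pair p q -> (l <= k)%N ->
  compat (smeet (ujoin k q p) q) (sjoin_i l p (ujoin k q p)).
Proof.
move=> pq lk j; rewrite [smeet _ q j]ffunE [sjoin_i l _ _ j]ffunE ujoinE.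
have : (j < l -> j < k)%N by move=> /leq_trans; apply.
by move: (pq j); do 2!case: (_ < _)%N => //; try (by move=> _ /(_ isT));
  case: (p j); case: (q j).
Qed.

Lemma sjoin_cross k l p q : full_pair p q -> (l <= k)%N ->
  sjoin_i 0 (smeet (ujoin k q p) q) (sjoin_i l p (ujoin k q p)) = ujoin k q p.
Proof.
move=> pq lk; apply/ffunP=> j; rewrite [LHS]ffunE ltn0 [smeet _ q j]ffunE.
rewrite [sjoin_i l _ _ j]ffunE ujoinE.
have : (j < l -> j < k)%N by move=> /leq_trans; apply.
by move: (pq j); do 2!case: (_ < _)%N => //; try (by move=> _ /(_ isT));
  case: (p j); case: (q j).
Qed.

Lemma smeet_cross k l p q : full_pair p q -> (l <= k)%N ->
  smeet (smeet (ujoin k q p) q) (sjoin_i l p (ujoin k q p)) =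
  smeet (ujoin l p q) q.
Proof.
move=> pq lk; apply/ffunP=> j; rewrite [LHS]ffunE [RHS]ffunE [smeet _ q j]ffunE.
rewrite [sjoin_i l _ _ j]ffunE !ujoinE.
have : (j < l -> j < k)%N by move=> /leq_trans; apply.
by move: (pq j); do 2!case: (_ < _)%N => //; try (by move=> _ /(_ isT));
  case: (p j); case: (q j).
Qed.

End Identities.

(** * Exchange inequalities *)

Lemma telescope_ord (V : zmodType) (F : nat -> V) k :
  \sum_(i < k) (F i.+1 - F i) = F k - F 0%N.
Proof. by rewrite -(big_mkord xpredT (fun i => F i.+1 - F i)) telescope_sumr. Qed.

Section RealInequalities.
Variables (R : realFieldType) (n : nat) (al : nat -> R).
Hypotheses (al0 : al 0 = 0) (alN : al n.+1 = 1).
Hypothesis al_step : forall i, al i <= al i.+1.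
Hypothesis al1_gt0 : 0 < al 1.
Variables (D : pred (S2n n)) (g : S2n n -> R).
Implicit Types (p q u v : S2n n) (i k l : nat).

Definition sigma_of (x : R) := x / (1 + x).

Local Notation dl i := (al i.+1 - al i).
Local Notation sg i := (sigma_of (al i)).
Local Notation cc i := (sigma_of (al i.+1) - sigma_of (al i)).

(* [D] stands for the domain of a function to [R + {oo}] and [g] for its finite
   part; terms with coefficient [0] may lie outside [D]. *)
Definition bisub_on := forall p q, D p -> D q ->
  [/\ D (smeet p q),
      forall i : 'I_n.+1, 0 < dl i -> D (sjoin_i i p q) &
      g (smeet p q) + \sum_(i < n.+1) dl i * g (sjoin_i i p q) <= g p + g q].

Definition sub_on := forall p q, D p -> D q ->
  [/\ D (smeet p q),
      forall i : 'I_n.+1, 0 < cc i -> D (ujoin i p q) &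
      g (smeet p q)
        + \sum_(i < n.+1) cc i * (g (ujoin i p q) + g (ujoin i q p))
      <= g p + g q].

Definition compat_submod := forall p q, compat p q -> D p -> D q ->
  [/\ D (smeet p q), D (sjoin_i 0 p q) &
      g (smeet p q) + g (sjoin_i 0 p q) <= g p + g q].

Lemma al_ge0 i : 0 <= al i.
Proof. by elim: i => [|i IH]; [rewrite al0|exact: le_trans IH (al_step i)]. Qed.

Lemma dl_ge0 i : 0 <= dl i. Proof. by rewrite subr_ge0. Qed.

Lemma sigmaK i : sg i * (1 + al i) = al i.
Proof. by rewrite divfK// gt_eqF// ltr_pwDl// al_ge0. Qed.

(** Clearing the denominators of s_(i+1) - s_i leaves d_i. Hence c_i and d_i are positive at the
    same levels, and both notions demand finiteness there. *)
Lemma ccE i : cc i * (1 + al i) * (1 + al i.+1) = dl i.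
Proof.
have -> : cc i * (1 + al i) * (1 + al i.+1) =
  sg i.+1 * (1 + al i.+1) * (1 + al i) - sg i * (1 + al i) * (1 + al i.+1).
  by ring.
by rewrite !sigmaK; ring.
Qed.

Lemma al1p_gt0 i : 0 < 1 + al i. Proof. by rewrite ltr_pwDl// al_ge0. Qed.

Lemma cc_ge0 i : 0 <= cc i.
Proof.
have := dl_ge0 i; rewrite -ccE -mulrA pmulr_lge0//.
by rewrite mulr_gt0// al1p_gt0.
Qed.

Lemma cc_gt0 i : (0 < cc i) = (0 < dl i).
Proof. by rewrite -ccE -mulrA pmulr_lgt0// mulr_gt0// al1p_gt0. Qed.

Lemma cc0 i : ~~ (0 < dl i) -> cc i = 0 /\ dl i = 0.
Proof.
move=> h; split; last by apply/eqP; move: h; rewrite lt_neqAle dl_ge0 andbT negbK eq_sym.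
by apply/eqP; move: h; rewrite -cc_gt0 lt_neqAle cc_ge0 andbT negbK eq_sym.
Qed.

Lemma sg0 : sg 0 = 0. Proof. by rewrite /sigma_of al0 mul0r. Qed.

Lemma sgN : sg n.+1 = 2^-1. Proof. by rewrite /sigma_of alN mul1r. Qed.

Lemma sum_dl k : \sum_(i < k) dl i = al k.
Proof. by rewrite telescope_ord al0 subr0. Qed.

Lemma sum_cc k : \sum_(i < k) cc i = sg k.
Proof. by rewrite (telescope_ord (fun i => sg i)) sg0 subr0. Qed.

(** Without conflict all levels of the join coincide, and the weights d_i sum to 1. Level 0 has
    positive weight d_0 = al_1. *)
Lemma bisub_compat : bisub_on -> compat_submod.
Proof.
move=> H p q pq Dp Dq; have [Dm Dj le] := H _ _ Dp Dq; split => //.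
  by apply: (Dj ord0); rewrite al0 subr0.
move: le; congr (_ <= _); congr (_ + _).
under eq_bigr do rewrite (compat_sjoin _ pq).
by rewrite -mulr_suml sum_dl alN mul1r.
Qed.

(** Without conflict u_i and u'_i both equal the join, and the weights c_i sum to 1/2. *)
Lemma sub_compat : sub_on -> compat_submod.
Proof.
move=> H p q pq Dp Dq; have [Dm Dj le] := H _ _ Dp Dq; split => //.
  rewrite -(compat_ujoin 0 pq).
  by apply: (Dj ord0); rewrite cc_gt0 al0 subr0.
move: le; congr (_ <= _); congr (_ + _).
have qp : compat q p by move=> j; move: (pq j); case: (p j); case: (q j).
under eq_bigr do rewrite (compat_ujoin _ pq) (compat_ujoin _ qp).
by rewrite -mulr_suml sum_cc sgN sjoin_iC; field.
Qed.

(** With e the level-0 join, add submodularity for the conflict-free pairs (p, e), (q, e) and (p /\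
    e, q /\ e); the values at p /\ e and q /\ e cancel. *)
Lemma full_pair_reduction p q : compat_submod ->
  D p -> D q -> D (sjoin_i 0 p q) ->
  [/\ D (ujoin 0 p q), D (ujoin 0 q p), D (smeet p q) &
      g (ujoin 0 p q) + g (ujoin 0 q p) + g (smeet p q)
      <= g p + g q + g (sjoin_i 0 p q)].
Proof.
move=> H Dp Dq De.
have [Dpm DP leP] := H _ _ (compat_sjoin0l p q) Dp De.
have qe : compat q (sjoin_i 0 p q) by rewrite sjoin_iC; exact: compat_sjoin0l.
have [Dqm DQ leQ] := H _ _ qe Dq De.
have [Dm _] := H _ _ (compat_smeet_sjoin0 p q) Dpm Dqm.
rewrite smeet_smeet_sjoin0 sjoin_smeet_sjoin0 in Dm * => leM.
have EQ : sjoin_i 0 q (sjoin_i 0 p q) = ujoin 0 q p by rewrite (sjoin_iC _ p).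
rewrite EQ in DQ leQ.
rewrite sjoin0_sjoin in DP leP.
split => //; lra.
Qed.

Lemma sub_bisub : sub_on -> bisub_on.
Proof.
move=> H p q Dp Dq.
have [Dm Du _] := H _ _ Dp Dq.
have [_ Du' _] := H _ _ Dq Dp.
have Dw (i : 'I_n.+1) : 0 < dl i -> D (sjoin_i i p q).
  move=> di; rewrite -smeet_ujoin.
  by have [] := H _ _ (Du i _) (Du' i _); rewrite ?cc_gt0.
have De : D (sjoin_i 0 p q) by apply: (Dw ord0); rewrite al0 subr0.
have [DP DQ _ red] := full_pair_reduction (sub_compat H) Dp Dq De.
split => //.
pose w i := g (sjoin_i i p q).
pose G i := g (ujoin i p q) + g (ujoin i q p).
(* Uncrossing the pair at level [i] reproduces the pairs at higher levels. *)
have Gi (i : 'I_n.+1) : 0 < dl i ->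
    w i + \sum_(l < n.+1) cc l * G (maxn i l) <= G i.
  move=> di; have ci : 0 < cc i by rewrite cc_gt0.
  have [_ _] := H _ _ (Du i ci) (Du' i ci).
  by under eq_bigr do rewrite !ujoin_ujoin; rewrite smeet_ujoin.
pose T i := \sum_(i <= l < n.+1) cc l * G l.
pose W i := \sum_(i <= l < n.+1) dl l * w l.
(* The terms with l < i all equal [G i] and have total weight s_i; moved to the right, they leave
   the factor 1 - s_i. *)
have GT (i : 'I_n.+1) : 0 < dl i -> w i + T i <= (1 - sg i) * G i.
  move=> /Gi; rewrite -(big_mkord xpredT (fun l => cc l * G (maxn i l))).
  rewrite (big_cat_nat (n:=i))//=; last by rewrite ltnW.
  rewrite (@eq_big_nat _ _ _ 0 i _ (fun l => cc l * G i)); last first.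
    by move=> l /andP[_ li]; rewrite (maxn_idPl _)// ltnW.
  rewrite -mulr_suml big_mkord sum_cc.
  rewrite (@eq_big_nat _ _ _ i n.+1 _ (fun l => cc l * G l)); last first.
    by move=> l /andP[il _]; rewrite (maxn_idPr _).
  by rewrite -/(T i) => h; lra.
(* Downward induction on the level: [m] counts from the top, where both tails are empty. *)
have TW m : (m <= n.+1)%N -> 
    W (n.+1 - m)%N <= (1 + al (n.+1 - m)%N) * T (n.+1 - m)%N.
  elim: m => [|m IH] mn; first by rewrite subn0 /W /T !big_geq// mulr0.
  have lt_in : (n.+1 - m.+1 < n.+1)%N by rewrite ltn_subrL.
  move: (IH (ltnW mn)); have -> : (n.+1 - m = (n.+1 - m.+1).+1)%N.
    by rewrite subnSK.
  move: (n.+1 - m.+1)%N lt_in => i lt_in {IH mn m} IH.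
  have WE : W i = dl i * w i + W i.+1 by rewrite {1}/W big_ltn.
  have TE : T i = cc i * G i + T i.+1 by rewrite {1}/T big_ltn.
  have := GT (Ordinal lt_in); rewrite /= WE TE; move: (T i.+1) (W i.+1) IH.
  move=> {GT WE TE} t Wi IH GT.
  (* If d_i = 0, the terms of level i vanish and al_i = al_(i+1), so the bound is inherited. *)
  have [di|/cc0[ci di]] := boolP (0 < dl i); last first.
    rewrite ci di !mul0r !add0r; have -> : al i = al i.+1 by lra.
    by [].
  have := GT di; have := sigmaK i; have := ccE i; have := al1p_gt0 i; have := al1p_gt0 i.+1.
  have := sigmaK i.+1.
  move: (G i) (w i) IH di {GT} (sg i) (sg i.+1) (al_ge0 i).
  move: (al i) (al i.+1) => x y Gi' wi IH di s s' x0 sy py px cE sx h.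
  (* Multiplies the bound by 1 + al_i, the inverse of 1 - s_i. *)
  have h1 : (1 + x) * (wi + ((s' - s) * Gi' + t)) <= Gi'.
    have EG : (1 + x) * ((1 - s) * Gi') = Gi'.
      by rewrite mulrA mulrBr mulr1 [_ * s]mulrC sx; ring.
    by rewrite -[leRHS]EG ler_pM2l.
  have eK : (1 + x) * ((1 + y) * ((s' - s) * Gi')) = (y - x) * Gi'.
    by rewrite -cE; ring.
  move: ((s' - s) * Gi') h1 eK => K h1 eK.
  (* Added to the induction hypothesis, this closes the step because d_i is the difference of 1 +
     al_(i+1) and 1 + al_i. *)
  have h2 : (y - x) * (wi + (K + t)) <= (1 + y) * K.
    by rewrite -(ler_pM2l px) eK mulrCA ler_pM2l.
  by move: h2 IH; rewrite !mulrDr !mulrDl !mul1r; lra.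
have [_ _] := H _ _ DP DQ.
under eq_bigr do rewrite !ujoin_ujoin max0n.
have -> : smeet (ujoin 0 p q) (ujoin 0 q p) = sjoin_i 0 p q by exact: smeet_ujoin.
(* At level 0 the factor 1 + al_0 is 1, so sum_i d_i w_i is at most sum_i c_i G_i. *)
move: (TW n.+1 (leqnn _)); rewrite subnn al0 addr0 mul1r /W /T !big_mkord /w /G.
move=> TW0 hPQ.
rewrite -(lerD2r (g (sjoin_i 0 p q))); apply: le_trans red.
by move: TW0 hPQ; lra.
Qed.

(** Let J_l be the l-th join of [p] and [v]. Bisubmodularity of (p, v) is added to the submodular
    inequalities of the conflict-free pairs (v /\ q, J_l) with weights d_l. These sum to 1, so the
    values at [v] and at the J_l cancel. *)
Lemma bisub_split p q v (Y : nat -> S2n n) : bisub_on -> D p -> D q -> D v ->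
  (forall l : 'I_n.+1, 0 < dl l ->
     [/\ compat (smeet v q) (sjoin_i l p v),
         sjoin_i 0 (smeet v q) (sjoin_i l p v) = v &
         smeet (smeet v q) (sjoin_i l p v) = Y l]) ->
  g (smeet v p) + \sum_(l < n.+1) dl l * g (Y l) <= g p + g (smeet v q).
Proof.
move=> H Dp Dq Dv HY.
have [_ DJ leJ] := H _ _ Dp Dv.
have [DX _ _] := H _ _ Dv Dq.
have : \sum_(l < n.+1) dl l * (g (Y l) + g v) <=
       \sum_(l < n.+1) dl l * (g (smeet v q) + g (sjoin_i l p v)).
  apply: ler_sum => l _; have [dl0|/cc0[_ ->]] := boolP (0 < dl l); last by rewrite !mul0r.
  have [XJ EJ EY] := HY l dl0.
  have [_ _] := bisub_compat H XJ DX (DJ l dl0).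
  by rewrite EJ EY => le; rewrite ler_pM2l.
rewrite [leLHS](eq_bigr (fun l : 'I_n.+1 => dl l * g (Y l) + dl l * g v)); last first.
  by move=> l _; rewrite mulrDr.
rewrite [leRHS](eq_bigr (fun l : 'I_n.+1 =>
  dl l * g (smeet v q) + dl l * g (sjoin_i l p v))); last first.
  by move=> l _; rewrite mulrDr.
rewrite !big_split/= -!mulr_suml sum_dl alN !mul1r.
by move: leJ; rewrite (smeetC p); lra.
Qed.

(** Exchanging the sums gives [x l] the total weight of the c_i with l < i < N, which telescopes. *)
Lemma exchange_dl_cc (x : nat -> R) N :
  \sum_(i < N) cc i * \sum_(l < i) dl l * x l =
  \sum_(l < N) dl l * x l * (sg N - sg l.+1).
Proof.
elim: N => [|N IH]; first by rewrite !big_ord0.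
rewrite big_ord_recr [RHS]big_ord_recr/= IH mulr_sumr -big_split/=.
rewrite subrr mulr0 addr0; apply: eq_bigr => l _; ring.
Qed.

Lemma sum_dl_min (x : nat -> R) i : (i <= n.+1)%N ->
  \sum_(l < n.+1) dl l * x (minn l i) =
  \sum_(l < i) dl l * x l + (1 - al i) * x i.
Proof.
move=> iN; rewrite -(big_mkord xpredT (fun l => dl l * x (minn l i))).
rewrite (big_cat_nat (n:=i))//=.
rewrite (@eq_big_nat _ _ _ 0 i _ (fun l => dl l * x l)); last first.
  by move=> l /andP[_ li]; rewrite (minn_idPl _)// ltnW.
rewrite (@eq_big_nat _ _ _ i n.+1 _ (fun l => dl l * x i)); last first.
  by move=> l /andP[il _]; rewrite (minn_idPr _).
by rewrite -mulr_suml big_mkord (telescope_sumr (fun l => al l))// alN.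
Qed.

(** By [sum_dl_min] the hypothesis reads y_i + sum_(l < i) d_l x_l <= a + al_i x_i; it is averaged
    with the weights c_i, of sum 1/2. *)
Lemma weighted_half (x y : nat -> R) a :
  (forall i : 'I_n.+1, 0 < dl i ->
     y i + \sum_(l < n.+1) dl l * x (minn l i) <= a + x i) ->
  \sum_(i < n.+1) cc i * (x i + y i) <=
    (a + \sum_(i < n.+1) dl i * x i) / 2.
Proof.
move=> Hi.
have : \sum_(i < n.+1) cc i * (y i + \sum_(l < i) dl l * x l) <=
       \sum_(i < n.+1) cc i * (a + al i * x i).
  apply: ler_sum => i _; have [di|/cc0[-> _]] := boolP (0 < dl i); last by rewrite !mul0r.
  rewrite ler_pM2l ?cc_gt0//.
  have := Hi i di; rewrite sum_dl_min; last by rewrite ltnW.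
  move: (\sum_(l < i) _) (x i) (y i) (al i) => S xi yi ai; lra.
have E1 : \sum_(i < n.+1) cc i * (y i + \sum_(l < i) dl l * x l) =
   \sum_(i < n.+1) (cc i * y i + dl i * x i * (sg n.+1 - sg i.+1)).
  rewrite [RHS]big_split/= -exchange_dl_cc -big_split/=.
  by apply: eq_bigr => i _; rewrite mulrDr.
have E2 : \sum_(i < n.+1) cc i * (a + al i * x i) =
    2^-1 * a + \sum_(i < n.+1) cc i * (al i * x i).
  rewrite -sgN -sum_cc mulr_suml -big_split/=.
  by apply: eq_bigr => i _; rewrite mulrDr.
rewrite {}E1 {}E2 -lerBlDr -sumrB => h.
have -> : (a + \sum_(i < n.+1) dl i * x i) / 2 =
    2^-1 * a + \sum_(i < n.+1) 2^-1 * (dl i * x i) by rewrite -mulr_sumr; ring.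
rewrite -lerBlDr -sumrB; apply: le_trans h.
rewrite le_eqVlt; apply/orP; left; apply/eqP; apply: eq_bigr => i _.
rewrite sgN; have := ccE i; have := sigmaK i.+1; have := sigmaK i => e1 e2 e3.
(* Both sides are d_i / (1 + al_(i+1)); this matches the coefficients of x_i. *)
have e4 : cc i * (1 + al i) = dl i * (1 - sg i.+1).
  apply: (mulIf (lt0r_neq0 (al1p_gt0 i.+1))).
  by rewrite e3 -mulrA [(1 - _) * _]mulrBl mul1r e2 addrK mulr1.
have : cc i * (1 + al i) * x i = dl i * (1 - sg i.+1) * x i by rewrite e4.
by lra.
Qed.

Lemma bisub_sub : bisub_on -> sub_on.
Proof.
move=> H p0 q0 Dp0 Dq0.
have [Dm Dw0 _] := H _ _ Dp0 Dq0.
have [_ Dw0' _] := H _ _ Dq0 Dp0.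
have De : D (sjoin_i 0 p0 q0) by apply: (Dw0 ord0); rewrite al0 subr0.
have [] := full_pair_reduction (bisub_compat H) Dp0 Dq0 De.
set p := ujoin 0 p0 q0; set q := ujoin 0 q0 p0 => Dp Dq _ red.
have pq : full_pair p q by exact: full_pair_ujoin.
have qp := full_pair_ujoin 0 q0 p0.
(* By definition [ujoin i r s] is an i-th join of [r] with an i-th join, so two applications of
   bisubmodularity reach it. *)
have Du0 r s (i : 'I_n.+1) : D r -> D s -> 0 < dl i -> D (ujoin i r s).
  move=> Dr Ds di; have [_ Dw _] := H _ _ Dr Ds.
  by have [_ Dj _] := H _ _ Dr (Dw i di); exact: Dj.
split => [//|i|]; first by rewrite cc_gt0; exact: Du0.
have Eu i : ujoin i p0 q0 = ujoin i p q by rewrite /p /q ujoin_ujoin max0n.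
have Eu' i : ujoin i q0 p0 = ujoin i q p by rewrite /p /q ujoin_ujoin max0n.
under eq_bigr do rewrite Eu Eu'.
have Ee : sjoin_i 0 p0 q0 = smeet p q by rewrite smeet_ujoin.
rewrite {}Ee in red De.
rewrite -(lerD2r (g (smeet p q))); apply: le_trans red; rewrite addrAC [leRHS]addrC.
rewrite -addrA lerD2l addrC.
have half r s : full_pair r s -> D r -> D s -> forall i : 'I_n.+1, 0 < dl i ->
    g (smeet (ujoin i r s) r) +
      \sum_(l < n.+1) dl l * g (smeet (ujoin (minn l i) r s) s)
    <= g r + g (smeet (ujoin i r s) s).
  move=> rs Dr Ds i di.
  apply: (bisub_split (Y := fun l => smeet (ujoin (minn l i) r s) s)) => //.
    exact: Du0.
  by move=> l _; split; [exact: compat_fill|exact: sjoin_fill|exact: smeet_fill].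
have hp := @weighted_half (fun i => g (smeet (ujoin i p q) q))
  (fun i => g (smeet (ujoin i p q) p)) _ (half _ _ pq Dp Dq).
have hq := @weighted_half (fun i => g (smeet (ujoin i q p) p))
  (fun i => g (smeet (ujoin i q p) q)) _ (half _ _ qp Dq Dp).
(* The last level of positive weight, so that l <= k for every contributing l. Level 0 is a
   candidate since d_0 = al_1. *)
pose k : 'I_n.+1 := [arg max_(i > ord0 | 0 < dl i) (i : nat)].
have [dk kmax] : 0 < dl k /\ forall l : 'I_n.+1, 0 < dl l -> (l <= k)%N.
  by rewrite /k; case: arg_maxnP => [|i di imax]; [rewrite al0 subr0|].
have cross : g (smeet (ujoin k q p) p) +
    \sum_(l < n.+1) dl l * g (smeet (ujoin l p q) q)
    <= g p + g (smeet (ujoin k q p) q).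
  apply: (bisub_split (Y := fun l => smeet (ujoin l p q) q)) => //.
    exact: Du0.
  move=> l /kmax lk.
  by split; [exact: compat_cross|exact: sjoin_cross|exact: smeet_cross].
have crossq := half _ _ qp Dq Dp k dk.
rewrite (eq_bigr (fun l : 'I_n.+1 => dl l * g (smeet (ujoin l q p) p))) in crossq; last first.
  move=> l _; have [/kmax lk|/cc0[_ ->]] := boolP (0 < dl l); last by rewrite !mul0r.
  by rewrite (minn_idPl lk).
have parts r s i : full_pair r s -> D r -> D s -> 0 < dl i -> (i < n.+1)%N ->
    g (smeet r s) + g (ujoin i r s) <=
    g (smeet (ujoin i r s) s) + g (smeet (ujoin i r s) r).
  move=> rs Dr Ds di iN; have Du := Du0 _ _ (Ordinal iN) Dr Ds di.
  have [Dx _ _] := H _ _ Du Dr; have [Dy _ _] := H _ _ Du Ds.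
  have [_ _] := bisub_compat H (compat_parts i r s) Dx Dy.
  by rewrite smeet_parts sjoin_parts// addrC [leRHS]addrC.
have parts_sum r s : full_pair r s -> D r -> D s ->
  g (smeet r s) / 2 + \sum_(i < n.+1) cc i * g (ujoin i r s) <=
  \sum_(i < n.+1) cc i * (g (smeet (ujoin i r s) s) + g (smeet (ujoin i r s) r)).
  move=> rs Dr Ds; rewrite mulrC -sgN -sum_cc mulr_suml -big_split/=.
  apply: ler_sum => i _; rewrite -mulrDr.
  have [di|/cc0[-> _]] := boolP (0 < dl i); last by rewrite !mul0r.
  by rewrite ler_pM2l ?cc_gt0// parts.
have sp := parts_sum _ _ pq Dp Dq.
have sq := parts_sum _ _ qp Dq Dp.
rewrite (eq_bigr (fun i : 'I_n.+1 => cc i * g (ujoin i p q) + cc i * g (ujoin i q p))); last first.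
  by move=> i _; rewrite mulrDr.
rewrite big_split/=.
rewrite (smeetC q p) in sq.
(* In [cross] + [crossq] the values at u'_k /\ p and u'_k /\ q cancel, which bounds sum_l d_l (g x_l
   + g x'_l) by g p + g q. Then [hp] + [hq] is bounded by g p + g q as well, and [sp], [sq] pass to
   u_i, u'_i and p /\ q. *)
lra.
Qed.

End RealInequalities.

(** * Shortest paths *)

Definition between (x y z : S2) : bool :=
  [|| z == x, z == y | (z == Z0) && opp_signs x y].

Section Interval.
Local Open Scope nat_scope.
Variable n : nat.
Implicit Types (p q r u w : S2n n).

(** The covering graph of [S2] is the path -, 0, + with positions [S2_to_nat]. Subtraction is
    truncated, so at most one summand is nonzero. *)
Definition s2dist (x y : S2) : nat :=
  (S2_to_nat x - S2_to_nat y) + (S2_to_nat y - S2_to_nat x).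

Definition sdist p q : nat := \sum_(j < n) s2dist (p j) (q j).

Definition set_coord p (j : 'I_n) x : S2n n :=
  [ffun k => if k == j then x else p k].

Lemma s2dist_triangle x y z : s2dist x z <= s2dist x y + s2dist y z.
Proof. by case: x; case: y; case: z. Qed.

Lemma sdist_triangle p q r : sdist p r <= sdist p q + sdist q r.
Proof. by rewrite -big_split/=; apply: leq_sum => j _; exact: s2dist_triangle. Qed.

Lemma sdist_eq0 p q : (sdist p q == 0) = (p == q).
Proof.
rewrite sum_nat_eq0; apply/forallP/eqP => [h|-> j]; last first.
  by rewrite /s2dist subnn.
by apply/ffunP => j; move: (h j); case: (p j); case: (q j).
Qed.

Lemma sdist_set_coord p q j x :
  sdist p q + s2dist x (q j) = sdist (set_coord p j x) q + s2dist (p j) (q j).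
Proof.
rewrite /sdist (bigD1 j)//= [in RHS](bigD1 j)//= ffunE eqxx.
rewrite [in RHS](eq_bigr (fun k => s2dist (p k) (q k))).
  by rewrite -addnA addnCA addnA addnC addnA.
by move=> k /negPf kj; rewrite ffunE kj.
Qed.

Lemma slt_coord p q : slt p q -> exists j, p j = Z0 /\ q j != Z0.
Proof.
move=> /andP[pq /forallP le].
have [j|h] := pickP (fun j => p j != q j).
  move=> pqj; exists j; move: (le j) pqj.
  by case: (p j); case: (q j).
by move: pq; rewrite (_ : p = q) ?eqxx//; apply/ffunP => j; apply/eqP/negbFE/h.
Qed.

Lemma covers_set_coord p j x : p j = Z0 -> x != Z0 -> covers p (set_coord p j x).
Proof.
move=> pj x0; have sE k : set_coord p j x k = if k == j then x else p k by rewrite ffunE.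
apply/andP; split.
  apply/andP; split.
    by apply/eqP => /ffunP/(_ j); rewrite sE eqxx pj => e; rewrite -e in x0.
  apply/forallP => k; rewrite sE; case: eqP => [->|_]; rewrite /s2le ?pj ?eqxx ?orbT//.
apply/forallP => z; apply/negP => /andP[pz zx].
have [k [pk zk]] := slt_coord pz; have [l [zl xl]] := slt_coord zx.
have le1 : forall i, s2le (p i) (z i) by move: pz => /andP[_ /forallP].
have le2 : forall i, s2le (z i) (set_coord p j x i) by move: zx => /andP[_ /forallP].
have kj : k = j.
  by apply/eqP; move: (le2 k); rewrite sE; case: eqP => // _; rewrite pk; move: zk; case: (z k).
have lj : l = j.
  apply/eqP; move: xl (le1 l); rewrite sE; case: (l =P j) => // _.
  by rewrite zl; case: (p l).
by move: zk zl; rewrite kj lj => /negPf h /eqP; rewrite h.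
Qed.

(** Copying one nonzero coordinate of [q] onto a zero of [p] already gives an element strictly above
    [p] and below [q], which must be [q]. *)
Lemma coversP p q : covers p q ->
  exists j, [/\ p j = Z0, q j != Z0 & q = set_coord p j (q j)].
Proof.
move=> /andP[pq /forallP h]; have [j [pj qj]] := slt_coord pq.
exists j; split => //; apply/eqP/negPn/negP => ne.
have /andP[lt _] := covers_set_coord pj qj.
move: (h (set_coord p j (q j))); rewrite lt/= /slt eq_sym ne/= => /negP; apply.
have /andP[_ /forallP le] := pq.
by apply/forallP => k; rewrite ffunE; case: eqP => // ->; rewrite /s2le eqxx orbT.
Qed.

Lemma sdist_cadj p q : cadj p q -> sdist p q <= 1.
Proof.
have aux x y : covers x y -> sdist x y <= 1 /\ sdist y x <= 1.
  move=> /coversP[j [xj yj ->]].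
  have := sdist_set_coord x x j (y j).
  have -> : sdist x x = 0 by apply/eqP; rewrite sdist_eq0.
  have := sdist_set_coord x (set_coord x j (y j)) j (y j).
  have -> : sdist (set_coord x j (y j)) (set_coord x j (y j)) = 0.
    by apply/eqP; rewrite sdist_eq0.
  by rewrite ffunE eqxx xj; case: (y j) yj => //= _; rewrite /s2dist/=; lia.
by move=> /orP[]/aux[].
Qed.

(** Where [p] and [q] differ, a zero of [p] moves to the sign in [q], and a sign of [p] moves to
    0. *)
Lemma cadj_step p q : p != q -> exists2 r, cadj p r & sdist p q = (sdist r q).+1.
Proof.
move=> pq; have [j pqj|h] := pickP (fun j => p j != q j); last first.
  by case/eqP: pq; apply/ffunP => j; apply/eqP/negbFE/h.
have [pj|pj] := eqVneq (p j) Z0.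
  exists (set_coord p j (q j)).
    by rewrite /cadj covers_set_coord// -pj eq_sym.
  have := sdist_set_coord p q j (q j).
  by move: pqj; rewrite pj /s2dist; case: (q j) => //=; lia.
exists (set_coord p j Z0).
  apply/orP; right; have := @covers_set_coord (set_coord p j Z0) j (p j).
  rewrite ffunE eqxx => /(_ erefl pj).
  congr (covers _ _); apply/ffunP => k; rewrite !ffunE.
  by case: eqP => // ->.
have := sdist_set_coord p q j Z0.
by move: pqj pj; rewrite /s2dist; case: (q j); case: (p j) => //=; lia.
Qed.

Lemma path_sdist p q :
  exists s, [/\ path (@cadj n) p s, last p s = q & size s = sdist p q].
Proof.
move: {2}(sdist p q) (erefl (sdist p q)) => m.
elim: m p => [|m IH] p dpq.
  by exists [::]; split => //; apply/eqP; rewrite -sdist_eq0 dpq.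
have [|r pr] := @cadj_step p q; first by rewrite -sdist_eq0 dpq.
rewrite dpq => -[drq]; have [s [rs sq ss]] := IH r (esym drq).
by exists (r :: s); rewrite /= pr ss -drq.
Qed.

Lemma size_path p s : path (@cadj n) p s -> sdist p (last p s) <= size s.
Proof.
elim: s p => [|r s IH] p /=; first by rewrite leqn0 sdist_eq0.
move=> /andP[/sdist_cadj pr /IH rs]; have := sdist_triangle p r (last r s); lia.
Qed.

(** Shortest paths have length [sdist], so [u] lies on one iff the triangle inequality through [u]
    is tight, and this holds iff it is tight in each coordinate. *)
Lemma IpqP p q u : Ipq p q u <-> forall j, between (p j) (q j) (u j).
Proof.
have betweenE x y z : between x y z = (s2dist x z + s2dist z y == s2dist x y).
  by case: x; case: y; case: z.
have sdistE : (forall j, between (p j) (q j) (u j)) <->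
    sdist p u + sdist u q <= sdist p q.
  rewrite -big_split/=; split => [h|h j].
    by apply: leq_sum => j _; rewrite (eqP (etrans (esym (betweenE _ _ _)) (h j))).
  rewrite betweenE eqn_leq s2dist_triangle andbT.
  move: h; rewrite /sdist (bigD1 j)//= [leqRHS](bigD1 j)//= => h.
  rewrite -(leq_add2r (\sum_(i < n | i != j) s2dist (p i) (q i))).
  by apply: leq_trans h; rewrite leq_add2l leq_sum// => i _; exact: s2dist_triangle.
rewrite sdistE; split.
  move=> [s [ps sq us smin]].
  have [t [pt tq <-]] := path_sdist p q; apply: leq_trans (smin t pt tq).
  move: us ps sq => /splitPl[s1 s2 s1u]; rewrite cat_path last_cat s1u size_cat.
  move=> /andP[/size_path ps1 /size_path us2] us2q.
  by move: ps1 us2; rewrite s1u us2q; lia.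
move=> le; have [s1 [ps1 s1u z1]] := path_sdist p u.
have [s2 [us2 s2q z2]] := path_sdist u q.
exists (s1 ++ s2); split.
- by rewrite cat_path ps1 s1u.
- by rewrite last_cat s1u.
- by rewrite -cat_cons mem_cat -{1}s1u mem_last.
- move=> t pt tq; rewrite size_cat z1 z2; apply: leq_trans le _.
  by rewrite -tq; exact: size_path.
Qed.

End Interval.

(** * Cones and edge weights *)

Section ConeMeasure.
Variable R : realType.
Implicit Types (x al be lo hi : R) (C : set (R * R)).

(** A direction (1 - s, s) with 0 <= s <= 1 belongs to it iff lo <= s <= hi. The ray at angle al has
    s = sin al / (sin al + cos al), so [C] is the length of an interval of s. *)
Definition ratio_cone lo hi : set (R * R) :=
  [set w | [/\ 0 <= w.1, 0 <= w.2, lo * (w.1 + w.2) <= w.2 &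
              w.2 <= hi * (w.1 + w.2)]].

Lemma angle_of_ratio x : 0 <= x <= 1 ->
  exists al, [/\ 0 <= al, al <= pi / 2 & sin al = x * (sin al + cos al)].
Proof.
move=> /andP[x0 x1].
pose d := x ^+ 2 + (1 - x) ^+ 2.
have d0 : 0 < d.
  by rewrite lt_neqAle /d addr_ge0 ?sqr_ge0// andbT eq_sym paddr_eq0 ?sqr_ge0// !sqrf_eq0; lra.
pose r := Num.sqrt d.
have r0 : 0 < r by rewrite sqrtr_gt0.
have rr : r ^+ 2 = d by rewrite sqr_sqrtr// ltW.
have c01 : 0 <= (1 - x) / r <= 1.
  apply/andP; split; first by rewrite divr_ge0 ?subr_ge0 ?(ltW r0).
  rewrite ler_pdivrMr// mul1r -(ger0_norm (x := 1 - x)) ?subr_ge0//.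
  by rewrite -sqrtr_sqr ler_wsqrtr// /d lerDr sqr_ge0.
have cin : -1 <= (1 - x) / r <= 1 by case/andP: c01 => c0 ->; rewrite andbT; lra.
exists (acos ((1 - x) / r)); split.
- exact: acos_ge0.
- rewrite -acos0 ; case/andP: c01 => c0 c1.
  rewrite leNgt; apply/negP => h.
  have : cos (acos ((1 - x) / r)) < cos (acos 0).
    rewrite ltr_cos// in_itv/= ?acos_ge0 ?acos_lepi//; lra.
  by rewrite !acosK ?in_itv/= ?cin//; lra.
- rewrite sin_acos// acosK ?in_itv//=.
  have -> : 1 - ((1 - x) / r) ^+ 2 = (x / r) ^+ 2.
    rewrite !expr_div_n rr; have dn0 := lt0r_neq0 d0.
    by apply: (mulIf dn0); rewrite mulrBl mul1r !divfK// /d; ring.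
  rewrite sqrtr_sqr ger0_norm ?divr_ge0// ?ltW//.
  by field; exact: lt0r_neq0.
Qed.

Lemma sinDcos_gt0 x : 0 <= x <= pi / 2 -> 0 < sin x + cos x.
Proof.
move=> /andP[x0 xpi].
have s0 : 0 <= sin x by apply: sin_ge0_pi; rewrite x0/=; have := pi_gt0 R; lra.
have c0 : 0 <= cos x by apply: cos_ge0_pihalf; rewrite xpi andbT; have := pi_gt0 R; lra.
rewrite lt_neqAle addr_ge0// andbT eq_sym; apply/eqP => h.
have := cos2Dsin2 x; nra.
Qed.

Lemma angle_coneE lo hi al be :
  0 <= be <= pi / 2 -> 0 <= al <= pi / 2 ->
  sin al = hi * (sin al + cos al) -> sin be = lo * (sin be + cos be) ->
  angle_cone al be = ratio_cone lo hi.
Proof.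
move=> be01 al01 ha hb.
have sa := sinDcos_gt0 al01; have sb := sinDcos_gt0 be01.
have ca : cos al = (1 - hi) * (sin al + cos al) by rewrite mulrBl mul1r -ha; ring.
have cb : cos be = (1 - lo) * (sin be + cos be) by rewrite mulrBl mul1r -hb; ring.
have eA w1 w2 : (w2 * cos al <= w1 * sin al) = (w2 <= hi * (w1 + w2)).
  transitivity (w2 * ((1 - hi) * (sin al + cos al)) <= w1 * (hi * (sin al + cos al))).
    by rewrite -ca -ha.
  by rewrite !mulrA ler_pM2r//; apply/idP/idP; lra.
have eB w1 w2 : (w1 * sin be <= w2 * cos be) = (lo * (w1 + w2) <= w2).
  transitivity (w1 * (lo * (sin be + cos be)) <= w2 * ((1 - lo) * (sin be + cos be))).
    by rewrite -cb -hb.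
  by rewrite !mulrA ler_pM2r//; apply/idP/idP; lra.
rewrite /angle_cone /ratio_cone.
by apply/seteqP; split => -[w1 w2] /= [w10 w20]; rewrite eA eB.
Qed.

(** [cone_measure] picks some angles, so these must exist and every choice must give the same value:
    the directions (1 - s, s) in the cone recover both end points. *)
Lemma cone_measure_ratio lo hi : 0 <= lo -> lo <= hi -> hi <= 1 ->
  cone_measure (ratio_cone lo hi) = hi - lo.
Proof.
move=> lo0 lohi hi1; rewrite /cone_measure; case: pselect => [H|[]]; last first.
  have [|al [al0 alpi ha]] := @angle_of_ratio hi; first by rewrite hi1 andbT; lra.
  have [|be [be0 bepi hb]] := @angle_of_ratio lo; first by rewrite lo0/=; lra.
  have al01 : 0 <= al <= pi / 2 by rewrite al0.
  have be01 : 0 <= be <= pi / 2 by rewrite be0.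
  exists (al, be); split => //=; last exact/esym/angle_coneE.
  have sa := sinDcos_gt0 al01; have sb := sinDcos_gt0 be01.
  (* If al < be, monotonicity of sin and cos makes sin al cos be - sin be cos al negative, but it is
     a nonnegative multiple of hi - lo. *)
  rewrite leNgt; apply/negP => lt.
  have : sin al < sin be.
    by rewrite ltr_sin// in_itv/=; have := pi_gt0 R; lra.
  have : cos be < cos al.
    by rewrite ltr_cos// in_itv/=; have := pi_gt0 R; lra.
  have e : sin al * cos be - sin be * cos al =
      (hi - lo) * ((sin al + cos al) * (sin be + cos be)).
    by rewrite mulrBl mulrA -ha mulrCA -hb; ring.
  have : 0 <= sin al * cos be - sin be * cos al.
    by rewrite e mulr_ge0 ?subr_ge0// ltW// mulr_gt0.
  have s0 : 0 <= sin al by rewrite ha mulr_ge0 ?(ltW sa)//; lra.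
  have c0 : 0 <= cos be by apply: cos_ge0_pihalf; rewrite bepi andbT; have := pi_gt0 R; lra.
  nra.
case: (cid H) => -[al be] /= [/= be0 beal alpi E].
have al01 : 0 <= al <= pi / 2 by rewrite alpi andbT; lra.
have be01 : 0 <= be <= pi / 2 by rewrite be0 /=; lra.
have sa := sinDcos_gt0 al01; have sb := sinDcos_gt0 be01.
set ha := sin al / _; set hb := sin be / _.
have Ea : sin al = ha * (sin al + cos al) by rewrite divfK// gt_eqF.
have Eb : sin be = hb * (sin be + cos be) by rewrite divfK// gt_eqF.
move: E; rewrite (angle_coneE be01 al01 Ea Eb) => E.
have ratioP a b t : 0 <= t <= 1 -> ratio_cone a b (1 - t, t) <-> a <= t <= b.
  move=> /andP[t0 t1]; rewrite /ratio_cone/= subrK !mulr1 subr_ge0.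
  by split => [[_ _ -> ->]|/andP[]].
have same t : 0 <= t <= 1 -> lo <= t <= hi <-> hb <= t <= ha.
  move=> t01; have Et := congr1 (fun C => C (1 - t, t)) E.
  have := ratioP lo hi t t01; have := ratioP hb ha t t01.
  by rewrite /= in Et; rewrite Et => <- <-.
have c0 x : 0 <= x <= pi / 2 -> 0 <= cos x.
  by move=> /andP[x0 xpi]; apply: cos_ge0_pihalf; rewrite xpi andbT; have := pi_gt0 R; lra.
have hb0 : 0 <= hb.
  by rewrite divr_ge0 ?(ltW sb)// sin_ge0_pi// be0/=; have := pi_gt0 R; lra.
have ha1 : ha <= 1 by rewrite ler_pdivrMr// mul1r lerDl c0.
have /same[+ _] : 0 <= lo <= 1 by rewrite lo0/=; lra.
rewrite lexx lohi => /(_ isT)/andP[hblo loha].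
have /same[+ _] : 0 <= hi <= 1 by rewrite hi1 andbT; lra.
rewrite lexx lohi => /(_ isT)/andP[hbhi hiha].
have /same[_] : 0 <= ha <= 1 by rewrite ha1 andbT; lra.
rewrite lexx andbT => /(_ (le_trans hblo loha))/andP[_ hahi].
have /same[_] : 0 <= hb <= 1 by rewrite hb0/=; lra.
rewrite lexx/= => /(_ (le_trans hblo loha))/andP[lohb _].
lra.
Qed.

End ConeMeasure.

(** * Extreme and maximal points of Conv I(p,q) *)

Section ExtremePoints.
Variables (R : realType) (n : nat) (a : 'I_n -> R).
Hypothesis a_pos : forall j, 0 < a j.
Variables p q : S2n n.
Implicit Types (u : S2n n) (w : R * R) (j k : 'I_n).

Local Notation conf j := (opp_signs (p j) (q j)).
Local Notation pt u := (vpt a u p q).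
Local Notation K := (convI a p q).

Definition gain1 j x := vcoord a j (s2meet x (p j)) - vcoord a j (s2meet (p j) (q j)).
Definition gain2 j x := vcoord a j (s2meet x (q j)) - vcoord a j (s2meet (p j) (q j)).

Definition dot w (z : R * R) : R := w.1 * z.1 + w.2 * z.2.

Lemma vpt1E u : (pt u).1 = \sum_j gain1 j (u j).
Proof. by rewrite /vpt/= /valpha -sumrB; apply: eq_bigr => j _; rewrite !ffunE. Qed.

Lemma vpt2E u : (pt u).2 = \sum_j gain2 j (u j).
Proof. by rewrite /vpt/= /valpha -sumrB; apply: eq_bigr => j _; rewrite !ffunE. Qed.

Local Opaque vpt.

Lemma dot_vpt w u :
  dot w (pt u) = \sum_j (w.1 * gain1 j (u j) + w.2 * gain2 j (u j)).
Proof. by rewrite /dot vpt1E vpt2E !mulr_sumr -big_split. Qed.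

Lemma sum_set_coord (F : 'I_n -> S2 -> R) u j x :
  \sum_k F k (set_coord u j x k) = \sum_k F k (u k) + (F j x - F j (u j)).
Proof.
rewrite (bigD1 j)//= [in RHS](bigD1 j)//= ffunE eqxx.
rewrite (eq_bigr (fun k => F k (u k))); first by ring.
by move=> k /negPf kj; rewrite ffunE kj.
Qed.

Lemma convI_vpt u : Ipq p q u -> K (pt u).
Proof.
move=> Iu; exists (fun u' => (u' == u)%:R); split.
- by move=> u'; rewrite ler0n.
- by move=> u' nI; case: eqP => // e; rewrite e in nI.
- by rewrite (bigD1 u)//= eqxx big1 ?addr0// => k /negPf ->.
- by rewrite (bigD1 u)//= eqxx mul1r big1 ?addr0// => k /negPf ->; rewrite mul0r.
- by rewrite (bigD1 u)//= eqxx mul1r big1 ?addr0// => k /negPf ->; rewrite mul0r.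
Qed.

Lemma convI_convex y z t : K y -> K z -> 0 <= t <= 1 ->
  K (t * y.1 + (1 - t) * z.1, t * y.2 + (1 - t) * z.2).
Proof.
move=> [l [l0 lI l1 ly1 ly2]] [m [m0 mI m1 mz1 mz2]] /andP[t0 t1].
exists (fun u => t * l u + (1 - t) * m u); split.
- by move=> u; rewrite addr_ge0// mulr_ge0// subr_ge0.
- by move=> u nI; rewrite lI// mI// !mulr0 addr0.
- by rewrite big_split/= -!mulr_sumr l1 m1 !mulr1 addrC subrK.
- rewrite /= ly1 mz1 !mulr_sumr -big_split/=; apply: eq_bigr => u _; ring.
- rewrite /= ly2 mz2 !mulr_sumr -big_split/=; apply: eq_bigr => u _; ring.
Qed.

Lemma dot_convI_le w c z :
  (forall u, Ipq p q u -> dot w (pt u) <= c) -> K z -> dot w z <= c.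
Proof.
move=> h [l [l0 lI l1 z1 z2]]; rewrite /dot z1 z2 !mulr_sumr -big_split/=.
rewrite -[c]mul1r -l1 mulr_suml; apply: ler_sum => u _.
have [Iu|nI] := pselect (Ipq p q u); last by rewrite lI// !mul0r !mulr0 addr0.
have := h _ Iu; rewrite /dot; move: (pt u).1 (pt u).2 => x y hxy.
have -> : w.1 * (l u * x) + w.2 * (l u * y) = l u * (w.1 * x + w.2 * y) by ring.
by rewrite ler_wpM2l.
Qed.

Lemma dot_convI_eq w u z :
  (forall u', Ipq p q u' -> u' != u -> dot w (pt u') < dot w (pt u)) ->
  K z -> dot w (pt u) <= dot w z -> z = pt u.
Proof.
move=> h [l [l0 lI l1 z1 z2]] le.
have le0 u' : 0 <= l u' * (dot w (pt u) - dot w (pt u')).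
  have [->|ne] := eqVneq u' u; first by rewrite subrr mulr0.
  have [Iu|nI] := pselect (Ipq p q u'); last by rewrite lI// mul0r.
  by rewrite mulr_ge0// subr_ge0 ltW// h.
have : \sum_u' l u' * (dot w (pt u) - dot w (pt u')) = 0.
  apply/eqP; rewrite eq_le sumr_ge0 ?andbT//.
  have -> : \sum_u' l u' * (dot w (pt u) - dot w (pt u')) = dot w (pt u) - dot w z.
    rewrite -[dot w (pt u) in RHS]mul1r -l1 mulr_suml /dot z1 z2 !mulr_sumr.
    by rewrite -big_split -sumrB/=; apply: eq_bigr => v _; ring.
  by rewrite subr_le0.
move/eqP; rewrite psumr_eq0// => /allP l0'.
have lz u' : u' != u -> l u' = 0.
  move=> ne; have [Iu|nI] := pselect (Ipq p q u'); last by rewrite lI.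
  have := l0' u' (mem_index_enum _); rewrite mulf_eq0 => /orP[/eqP//|].
  by rewrite gt_eqF// subr_gt0 h.
have lu : l u = 1 by rewrite -l1 (bigD1 u)//= big1 ?addr0.
rewrite [z]surjective_pairing [pt u]surjective_pairing z1 z2.
rewrite (bigD1 u)//= lu mul1r big1 ?addr0; last by move=> v /lz ->; rewrite mul0r.
by rewrite (bigD1 u)//= lu mul1r big1 ?addr0// => v /lz ->; rewrite mul0r.
Qed.

(** A point dominating [pt u], or the ends of a segment through it, must reach the same maximal
    value of [dot w]; by strictness they coincide with [pt u]. *)
Lemma unique_max_Epq w u : 0 <= w.1 -> 0 <= w.2 -> Ipq p q u ->
  (forall u', Ipq p q u' -> u' != u -> dot w (pt u') < dot w (pt u)) ->
  Epq a p q u.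
Proof.
move=> w10 w20 Iu h.
have mx z : K z -> dot w z <= dot w (pt u).
  apply: dot_convI_le => v Iv; have [->//|ne] := eqVneq v u.
  exact/ltW/h.
split => //; split; try exact: convI_vpt.
  move=> y z t Ky Kz /andP[t0 t1] e1 e2.
  have e : dot w (pt u) = t * dot w y + (1 - t) * dot w z.
    by rewrite {1}/dot e1 e2 /dot; ring.
  have := mx _ Ky; have := mx _ Kz => hz hy.
  split; apply: (dot_convI_eq h) => //.
    have : (1 - t) * dot w z <= (1 - t) * dot w (pt u) by rewrite ler_wpM2l// subr_ge0 ltW.
    by move=> ?; rewrite -(ler_pM2l t0); lra.
  have t1' : 0 < 1 - t by rewrite subr_gt0.
  have : t * dot w y <= t * dot w (pt u) by rewrite ler_wpM2l// ltW.
  by move=> ?; rewrite -(ler_pM2l t1'); lra.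
move=> [y [Ky y1 y2]]; apply; apply: (dot_convI_eq h) => //.
by rewrite lerD// ler_wpM2l.
Qed.

Definition saturated u := forall j,
  if conf j then (u j == p j) || (u j == q j) else u j == s2join (p j) (q j).

Lemma saturatedI u : saturated u -> Ipq p q u.
Proof.
move=> su; apply/IpqP => j; move: (su j).
by case: (p j); case: (q j); case: (u j).
Qed.

Lemma saturated_ujoin i : saturated (ujoin i p q).
Proof.
by move=> j; rewrite ujoinE; case: ltnP; case: (p j); case: (q j).
Qed.

Lemma saturated_ujoinC i : saturated (ujoin i q p).
Proof.
by move=> j; rewrite ujoinE; case: ltnP; case: (p j); case: (q j).
Qed.

Lemma saturated_eq u u' : saturated u -> saturated u' ->
  (forall j, conf j -> u j = u' j) -> u = u'.
Proof.
move=> su su' h; apply/ffunP => j; move: (su j) (su' j) (h j).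
by case: ifP => _ => [_ _ ->//|/eqP -> /eqP ->].
Qed.

(** At an unsaturated coordinate, passing to + in a conflict or to the join otherwise raises the sum
    of the two gains and lowers neither. *)
Lemma cw_max_saturated u : Ipq p q u -> cw_maximal K (pt u) -> saturated u.
Proof.
move=> /[dup] Iu /IpqP bu [_ mx] j; apply/negPn/negP => nsu; apply: mx.
pose x := if conf j then Pl else s2join (p j) (q j).
have Ix : Ipq p q (set_coord u j x).
  apply/IpqP => k; rewrite ffunE; case: eqP => // ->.
  by rewrite /x; case: (p j); case: (q j).
exists (pt (set_coord u j x)).
have e1 : (pt (set_coord u j x)).1 = (pt u).1 + (gain1 j x - gain1 j (u j)).
  by rewrite !vpt1E sum_set_coord.
have e2 : (pt (set_coord u j x)).2 = (pt u).2 + (gain2 j x - gain2 j (u j)).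
  by rewrite !vpt2E sum_set_coord.
have [d1 d2 d] : [/\ gain1 j (u j) <= gain1 j x, gain2 j (u j) <= gain2 j x &
    gain1 j (u j) + gain2 j (u j) < gain1 j x + gain2 j x].
  have aj := a_pos j; move: (bu j) nsu; rewrite /x /gain1 /gain2.
  by case: (p j); case: (q j); case: (u j) => //= _ _; split; lra.
split; first exact: convI_vpt.
- by rewrite e1 lerDl subr_ge0.
- by rewrite e2 lerDl subr_ge0.
- by move=> e; move: e1 e2; rewrite e; lra.
Qed.

Definition vp j := vcoord a j (p j).
Definition vq j := vcoord a j (q j).
(** In a conflict, the s at which the direction (1 - s, s) rates p_j and q_j equally: p_j is better
    below it, q_j above. *)
Definition threshold j := vp j / (vp j + vq j).

Lemma conf_gt0 j : conf j -> 0 < vp j /\ 0 < vq j.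
Proof.
by have := a_pos j; rewrite /vp /vq; case: (p j); case: (q j) => //= ? _; split.
Qed.

Lemma threshold01 j : conf j -> 0 < threshold j < 1.
Proof.
move=> /conf_gt0[p0 q0]; rewrite divr_gt0 ?addr_gt0//=.
by rewrite ltr_pdivrMr ?addr_gt0// mul1r ltrDl.
Qed.

(* Moving [j] back towards [p] and [k] towards [q] would trade at a better
   rate than [pt u] if the thresholds were in the wrong order. *)
Lemma cw_max_threshold u j k : saturated u -> cw_maximal K (pt u) ->
  conf j -> u j = q j -> conf k -> u k = p k -> threshold j <= threshold k.
Proof.
move=> su [_ mx] cj uj ck uk; rewrite leNgt; apply/negP => lt; apply: mx.
have [pj0 qj0] := conf_gt0 cj; have [pk0 qk0] := conf_gt0 ck.
have cross : vp k * vq j < vp j * vq k.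
  move: lt; rewrite /threshold ltr_pdivrMr ?addr_gt0// mulrAC ltr_pdivlMr ?addr_gt0//.
  by lra.
have Iu := saturatedI su; have /IpqP bu := Iu.
pose u1 := set_coord u j (p j); pose u2 := set_coord u k (q k).
have I1 : Ipq p q u1.
  by apply/IpqP => i; rewrite ffunE; case: eqP => // ->; rewrite /between eqxx.
have I2 : Ipq p q u2.
  by apply/IpqP => i; rewrite ffunE; case: eqP => // ->; rewrite /between eqxx orbT.
have gj : [/\ gain1 j (p j) = vp j, gain1 j (q j) = 0, gain2 j (p j) = 0 & gain2 j (q j) = vq j].
  by rewrite /gain1 /gain2 /vp /vq; case: (p j) (q j) cj => [] [] //= _; split; lra.
have gk : [/\ gain1 k (p k) = vp k, gain1 k (q k) = 0, gain2 k (p k) = 0 & gain2 k (q k) = vq k].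
  by rewrite /gain1 /gain2 /vp /vq; case: (p k) (q k) ck => [] [] //= _; split; lra.
case: gj gk => g1 g2 g3 g4 [h1 h2 h3 h4].
have e11 : (pt u1).1 = (pt u).1 + vp j by rewrite !vpt1E sum_set_coord uj g1 g2 subr0.
have e12 : (pt u1).2 = (pt u).2 - vq j by rewrite !vpt2E sum_set_coord uj g3 g4 sub0r.
have e21 : (pt u2).1 = (pt u).1 - vp k by rewrite !vpt1E sum_set_coord uk h1 h2 sub0r.
have e22 : (pt u2).2 = (pt u).2 + vq k by rewrite !vpt2E sum_set_coord uk h3 h4 subr0.
(* The weight [t] is chosen so that the mixture of [u1] and [u2] keeps the second component of
   [pt u]; [cross] then makes its first component strictly larger. *)
pose S := vq j + vq k; have S0 : 0 < S by rewrite addr_gt0.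
pose t := vq k / S.
have tS : t * S = vq k by rewrite divfK// gt_eqF.
have t01 : 0 <= t <= 1.
  by rewrite divr_ge0 ?(ltW S0) ?(ltW qk0)//= ler_pdivrMr// mul1r lerDr ltW.
have := convI_convex (convI_vpt I1) (convI_vpt I2) t01.
set z := (X in K X) => Kz.
have z1E : z.1 = (pt u).1 + (t * (vp j + vp k) - vp k).
  by rewrite /z [LHS]/= e11 e21; ring.
have z2 : z.2 = (pt u).2.
  have -> : z.2 = (pt u).2 + (vq k - t * S) by rewrite /z [LHS]/= e12 e22 /S; ring.
  by rewrite tS subrr addr0.
have z1 : (pt u).1 < z.1.
  rewrite z1E ltrDl subr_gt0 -(ltr_pM2r S0) mulrAC tS.
  by rewrite /S; lra.
exists z; split => //; [exact: ltW|by rewrite z2|].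
by move=> e; move: z1; rewrite e ltxx.
Qed.

End ExtremePoints.

(** * The directions maximized by a given element *)

Section Cones.
Variables (R : realType) (n : nat) (a : 'I_n -> R).
Hypothesis a_pos : forall j, 0 < a j.
Variables p q : S2n n.
Implicit Types (u : S2n n) (w : R * R) (j k : 'I_n).

Local Notation conf j := (opp_signs (p j) (q j)).
Local Notation pt u := (vpt a u p q).
Local Notation K := (convI a p q).
Local Notation sat := (saturated p q).
Local Notation thr := (threshold a p q).
Local Opaque vpt.

Lemma threshold_le j w : conf j ->
  (thr j * (w.1 + w.2) <= w.2) =
  (w.1 * vp a p j <= w.2 * vq a q j).
Proof.
move=> /(conf_gt0 a_pos)[p0 q0]; rewrite /threshold mulrAC ler_pdivrMr ?addr_gt0//.
by apply/idP/idP; lra.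
Qed.

Lemma threshold_ge j w : conf j ->
  (w.2 <= thr j * (w.1 + w.2)) =
  (w.2 * vq a q j <= w.1 * vp a p j).
Proof.
move=> /(conf_gt0 a_pos)[p0 q0]; rewrite /threshold mulrAC ler_pdivlMr ?addr_gt0//.
by apply/idP/idP; lra.
Qed.

Definition face_cond w u j := conf j ->
  (u j = q j -> w.1 * vp a p j <= w.2 * vq a q j) /\
  (u j = p j -> w.2 * vq a q j <= w.1 * vp a p j).

Lemma coord_dot_le w u j x : 0 <= w.1 -> 0 <= w.2 -> sat u ->
  face_cond w u j -> between (p j) (q j) x ->
  w.1 * gain1 a p q j x + w.2 * gain2 a p q j x <=
  w.1 * gain1 a p q j (u j) + w.2 * gain2 a p q j (u j).
Proof.
move=> w10 w20 su; have aj := ltW (a_pos j).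
have := mulr_ge0 w10 aj; have := mulr_ge0 w20 aj.
move: (su j); rewrite /face_cond /gain1 /gain2 /vp /vq.
case: (p j) (q j) (u j) x => [] [] [] [] //= _ ? ? h _;
  try (case: (h isT) => h1 h2; try have := h1 erefl; try have := h2 erefl); lra.
Qed.

Lemma coord_dot_lt w u j x : 0 < w.1 -> 0 < w.2 -> sat u ->
  (conf j -> (u j = q j -> w.1 * vp a p j < w.2 * vq a q j) /\
             (u j = p j -> w.2 * vq a q j < w.1 * vp a p j)) ->
  between (p j) (q j) x -> x != u j ->
  w.1 * gain1 a p q j x + w.2 * gain2 a p q j x <
  w.1 * gain1 a p q j (u j) + w.2 * gain2 a p q j (u j).
Proof.
move=> w10 w20 su; have aj := a_pos j.
have := mulr_gt0 w10 aj; have := mulr_gt0 w20 aj.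
move: (su j); rewrite /gain1 /gain2 /vp /vq.
case: (p j) (q j) (u j) x => [] [] [] [] //= _ ? ? h _ _;
  try (case: (h isT) => h1 h2; try have := h1 erefl; try have := h2 erefl); lra.
Qed.

(** The functional is a sum of independent coordinate terms, so optimality is tested by changing one
    coordinate at a time; outside conflicts the join is optimal. *)
Lemma ConeP u w : sat u -> 0 <= w.1 -> 0 <= w.2 ->
  Cone a u p q w <-> forall j, face_cond w u j.
Proof.
move=> su w10 w20; split=> [[_ _ mx] j cj|h]; last first.
  split => // z Kz; rewrite -!/(dot _ _); apply: dot_convI_le Kz => v /IpqP bv.
  by rewrite !dot_vpt; apply: ler_sum => j _; exact: coord_dot_le.
have /IpqP bu := saturatedI su.
have better x : between (p j) (q j) x ->
    w.1 * gain1 a p q j x + w.2 * gain2 a p q j x <=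
    w.1 * gain1 a p q j (u j) + w.2 * gain2 a p q j (u j).
  move=> bx; have Ix : Ipq p q (set_coord u j x).
    by apply/IpqP => k; rewrite ffunE; case: eqP => // ->.
  have := mx _ (convI_vpt a Ix); rewrite -!/(dot _ _) !dot_vpt.
  rewrite (sum_set_coord (fun k y => w.1 * gain1 a p q k y + w.2 * gain2 a p q k y)).
  by rewrite gerDl subr_le0.
have := better (p j); have := better (q j); rewrite /between !eqxx orbT/=.
move=> /(_ isT) + /(_ isT); move: cj; rewrite /gain1 /gain2 /vp /vq.
by case: (p j) (q j) (u j) => [] [] [] //= _; split => // _; lra.
Qed.

(** A saturated [u] is optimal from the last switch to q_j already made up to the first one still to
    come. The defaults 0 and 1 are the ends of the range of s. *)
Definition lo_of u : R :=
  \big[Num.max/0]_(j | conf j && (u j == q j)) thr j.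
Definition hi_of u : R :=
  \big[Num.min/1]_(j | conf j && (u j == p j)) thr j.

Lemma lo_of_ge0 u : 0 <= lo_of u.
Proof. by have /bigmax_leP[] : lo_of u <= lo_of u by []. Qed.

Lemma hi_of_le1 u : hi_of u <= 1.
Proof. by have /bigmin_geP[] : hi_of u <= hi_of u by []. Qed.

Lemma threshold_le_lo u j : conf j -> u j = q j -> thr j <= lo_of u.
Proof.
move=> cj uj; have /bigmax_leP[_] : lo_of u <= lo_of u by [].
by apply; rewrite cj uj eqxx.
Qed.

Lemma hi_le_threshold u j : conf j -> u j = p j -> hi_of u <= thr j.
Proof.
move=> cj uj; have /bigmin_geP[_] : hi_of u <= hi_of u by [].
by apply; rewrite cj uj eqxx.
Qed.

Lemma lo_of_le u x : 0 <= x ->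
  (forall j, conf j -> u j = q j -> thr j <= x) -> lo_of u <= x.
Proof. by move=> x0 h; apply/bigmax_leP; split => // j /andP[cj /eqP]; exact: h. Qed.

Lemma hi_of_ge u x : x <= 1 ->
  (forall j, conf j -> u j = p j -> x <= thr j) -> x <= hi_of u.
Proof. by move=> x1 h; apply/bigmin_geP; split => // j /andP[cj /eqP]; exact: h. Qed.

Lemma Cone_ratio u : sat u ->
  Cone a u p q = ratio_cone (lo_of u) (hi_of u).
Proof.
move=> su; apply/seteqP; split => w.
  move=> /[dup] -[w10 w20 _] /(ConeP su w10 w20) h; split => //.
    have [W0|W0] := eqVneq (w.1 + w.2) 0; first by rewrite W0 mulr0.
    have Wp : 0 < w.1 + w.2 by rewrite lt_neqAle eq_sym W0 addr_ge0.
    rewrite -ler_pdivlMr//; apply: lo_of_le; first by rewrite divr_ge0// ltW.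
    by move=> j cj uj; rewrite ler_pdivlMr// threshold_le//; apply: (h j cj).1.
  have [W0|W0] := eqVneq (w.1 + w.2) 0; first by rewrite W0 mulr0; lra.
  have Wp : 0 < w.1 + w.2 by rewrite lt_neqAle eq_sym W0 addr_ge0.
  rewrite -ler_pdivrMr//; apply: hi_of_ge; first by rewrite ler_pdivrMr// mul1r lerDr.
  by move=> j cj uj; rewrite ler_pdivrMr// threshold_ge//; apply: (h j cj).2.
move=> [w10 w20 l h]; apply/(ConeP su w10 w20) => j cj; split=> uj.
  rewrite -threshold_le//; apply: le_trans l.
  by rewrite ler_wpM2r ?addr_ge0// threshold_le_lo.
rewrite -threshold_ge//; apply: le_trans h _.
by rewrite ler_wpM2r ?addr_ge0// hi_le_threshold.
Qed.

(** The midpoint of the interval avoids all thresholds, so [u] is the only maximizer of that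
    direction. *)
Lemma lo_lt_hi_Epq u : sat u -> lo_of u < hi_of u -> Epq a p q u.
Proof.
move=> su lt; pose s := (lo_of u + hi_of u) / 2.
have := lo_of_ge0 u; have := hi_of_le1 u => h1 l0.
have s0 : 0 < s by rewrite /s; lra.
have s1 : 0 < 1 - s by rewrite /s; lra.
apply: (@unique_max_Epq _ _ _ _ _ (1 - s, s)); rewrite /= ?ltW//.
  exact: saturatedI.
move=> v /IpqP bv vu; rewrite !dot_vpt.
have strict j : v j != u j ->
    (1 - s) * gain1 a p q j (v j) + s * gain2 a p q j (v j) <
    (1 - s) * gain1 a p q j (u j) + s * gain2 a p q j (u j).
  apply: (@coord_dot_lt (1 - s, s)) => //= cj; split => uj.
    rewrite ltNge -(@threshold_ge j (1 - s, s))//= subrK mulr1 -ltNge.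
    by have := threshold_le_lo cj uj; rewrite /s; lra.
  rewrite ltNge -(@threshold_le j (1 - s, s))//= subrK mulr1 -ltNge.
  by have := hi_le_threshold cj uj; rewrite /s; lra.
have [j vj] : exists j, v j != u j.
  apply/existsP; rewrite -negb_forall; apply: contra vu => /forallP h.
  by apply/eqP/ffunP => j; exact/eqP.
rewrite (bigD1 j)//= [ltRHS](bigD1 j)//= ltr_leD ?strict//.
apply: ler_sum => k _; have [->//|/strict/ltW//] := eqVneq (v k) (u k).
Qed.

Lemma Epq_lo_le_hi u : Epq a p q u -> sat u /\ lo_of u <= hi_of u.
Proof.
move=> [Iu _ mx]; have su := cw_max_saturated a_pos Iu mx; split => //.
apply: lo_of_le => [|j cj uj].
  by apply: hi_of_ge => // k /(threshold01 a_pos)/andP[/ltW].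
apply: hi_of_ge => [|k ck uk]; first by have /andP[_ /ltW] := threshold01 a_pos cj.
exact: cw_max_threshold mx _ _ _ _.
Qed.

Definition Epq_weight u : R :=
  if `[< Epq a p q u >] then cone_measure (Cone a u p q) else 0.

(** When the two ends coincide, the value is 0 whether or not [u] belongs to E(p,q). *)
Lemma Epq_weightE u : sat u -> lo_of u <= hi_of u ->
  Epq_weight u = hi_of u - lo_of u.
Proof.
move=> su le; rewrite /Epq_weight; case: asboolP => [Eu|nE].
  by rewrite (Cone_ratio su) cone_measure_ratio ?lo_of_ge0 ?hi_of_le1.
move: le; rewrite le_eqVlt => /orP[/eqP->|/(lo_lt_hi_Epq su)//].
by rewrite subrr.
Qed.

Lemma Epq_weight0 u : ~ (sat u /\ lo_of u <= hi_of u) -> Epq_weight u = 0.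
Proof.
by move=> h; rewrite /Epq_weight; case: asboolP => // /Epq_lo_le_hi.
Qed.

Definition clip u x := Num.min (Num.max x (lo_of u)) (hi_of u).

(** For a saturated [v] and 0 <= x, y <= 1: [v] is optimal for every s between [x] and [y]. *)
Definition separates (v : S2n n) x y := forall j, conf j ->
  (v j = q j /\ thr j <= x) \/ (v j = p j /\ y <= thr j).

Lemma separates_in u x y : 0 <= x -> y <= 1 -> separates u x y ->
  lo_of u <= x /\ y <= hi_of u.
Proof.
move=> x0 y1 sep; split.
  apply: lo_of_le => // j cj uj; case: (sep j cj) => -[] // e.
  by move: cj; rewrite -uj -e; case: (u j).
apply: hi_of_ge => // j cj uj; case: (sep j cj) => -[] // e.
by move: cj; rewrite -uj -e; case: (u j).
Qed.

(* An interval of directions lies between [lo_of u] and [hi_of u] if [u] is its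
   maximizer and outside of them otherwise, so that the lengths of the intervals
   maximized by [u] telescope. *)
Lemma clip_diff u v x y : sat u -> sat v -> lo_of u <= hi_of u ->
  0 <= x -> x <= y -> y <= 1 -> separates v x y ->
  clip u y - clip u x = (y - x) * (v == u)%:R.
Proof.
move=> su sv le x0 xy y1 sep; have [e|ne] := eqVneq v u.
  rewrite e in sep; have [lx yh] := separates_in x0 y1 sep.
  rewrite /clip !max_l ?min_l ?mulr1//; lra.
have [j [cj vuj]] : exists j, conf j /\ v j != u j.
  have [//|h] := pselect (exists j, conf j /\ v j != u j).
  case/eqP: ne; apply: (saturated_eq sv su) => j cj.
  by apply/eqP/negPn/negP => ne; apply: h; exists j.
rewrite mulr0; apply/eqP; rewrite subr_eq0; apply/eqP.
(* The threshold of a coordinate where [u] and [v] differ puts [x] and [y] on the same side of the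
   interval of [u], so both are clipped to the same end. *)
have := su j; rewrite cj => /orP[]/eqP uj.
  case: (sep j cj) => -[vj h]; last by rewrite vj uj eqxx in vuj.
  have := hi_le_threshold cj uj => h'; rewrite /clip !min_r// le_max.
    by apply/orP; left; lra.
  by apply/orP; left; lra.
case: (sep j cj) => -[vj h]; first by rewrite vj uj eqxx in vuj.
have := threshold_le_lo cj uj => h'; rewrite /clip !max_r//; lra.
Qed.

End Cones.

(** * The weights of the elements u_i and u'_i *)

Section EdgeWeights.
Variables (R : realType) (n : nat) (a : 'I_n -> R).
Hypothesis a_pos : forall j, 0 < a j.
Hypothesis a_mono : forall j k : 'I_n, (j <= k)%N -> a j <= a k.
Hypothesis a_le1 : forall j, a j <= 1.
Variables p q : S2n n.
Implicit Types (u : S2n n) (i : nat) (j k : 'I_n).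

Local Notation conf j := (opp_signs (p j) (q j)).
Local Notation sg i := (sigma_of (alpha_ext a i)).

Lemma alpha_extS j : alpha_ext a j.+1 = a j.
Proof. by rewrite /= valK. Qed.

Lemma alpha_extN : alpha_ext a n.+1 = 1.
Proof. by rewrite /= insubF// ltnn. Qed.

Lemma alpha_ext_step i : alpha_ext a i <= alpha_ext a i.+1.
Proof.
case: i => [|i] /=; first by case: insubP => [j _ _|_]; rewrite ?ltW.
case: insubP => [j _ ji|ni].
  by case: insubP => [k _ ki|_]; rewrite ?a_mono// ji ki.
by rewrite insubN//; move: ni; rewrite -!leqNgt; exact: leqW.
Qed.

Lemma alpha_ext1_gt0 : 0 < alpha_ext a 1.
Proof. by rewrite /=; case: insubP. Qed.

Lemma sg_homo i l : (i <= l)%N -> sg i <= sg l.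
Proof.
move=> /subnK <-; elim: (l - i)%N => [//|m IH]; rewrite addSn.
apply: le_trans IH _.
by rewrite -subr_ge0; apply: cc_ge0 => //; exact: alpha_ext_step.
Qed.

Lemma sg_ge0 i : 0 <= sg i.
Proof. by have := sg_homo (leq0n i); rewrite {1}/sigma_of mul0r. Qed.

Lemma sg_half i : (i <= n.+1)%N -> sg i <= 2^-1.
Proof. by move=> /sg_homo; rewrite sgN ?alpha_extN. Qed.

Lemma thresholdE j : conf j -> threshold a p q j =
  if p j == Mn then sg j.+1 else 1 - sg j.+1.
Proof.
have a1 : 1 + a j != 0 by rewrite gt_eqF// ltr_pwDr// ltW.
rewrite /threshold /vp /vq /sigma_of alpha_extS.
case: (p j) (q j) => [] [] //= _; rewrite ?[a j + 1]addrC//.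
by field.
Qed.

(** Here s is at most 1/2. Conflicts with p_j = + have threshold at least 1/2 and keep p_j; those
    with p_j = - have threshold s_(j+1), as [j] counts from 0, and have switched iff j < i. *)
Lemma separates_left i : (i <= n)%N -> separates a p q (ujoin i p q) (sg i) (sg i.+1).
Proof.
move=> iN j cj; rewrite thresholdE// ujoinE cj.
have jn := ltn_ord j; have := sg_half (leqW jn); have := @sg_half i.+1 iN.
case: ltnP => ji; [move: (sg_homo ji)|move: (@sg_homo i.+1 j.+1 ji)];
  case: (p j) (q j) cj => [] [] //= _ h1 h2 h3; try (by left); right; split=> //; lra.
Qed.

Lemma separates_right i : (i <= n)%N ->
  separates a p q (ujoin i q p) (1 - sg i.+1) (1 - sg i).
Proof.
move=> iN j cj; rewrite thresholdE// ujoinE.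
have -> : opp_signs (q j) (p j) by case: (p j) (q j) cj => [] [].
have jn := ltn_ord j; have := sg_half (leqW jn); have := @sg_half i.+1 iN.
case: ltnP => ji.
  move: (sg_homo ji); case: (p j) (q j) cj => [] [] //= _ h1 h2 h3;
  [left|right]; split=> //; lra.
have := @sg_homo i.+1 j.+1 ji.
case: (p j) (q j) cj => [] [] //= _ h1 h2 h3; left; split=> //; lra.
Qed.

(** The intervals from s_i to s_(i+1) and their mirror images under s -> 1 - s tile [0, 1], with
    maximizers u_i and u'_i. Clipping them to the interval of [u] and telescoping gives hi - lo. *)
Lemma Epq_weight_sum u : Epq_weight a p q u =
  \sum_(i < n.+1) (sg i.+1 - sg i) *
     ((ujoin i p q == u)%:R + (ujoin i q p == u)%:R).
Proof.
have sgi (i : 'I_n.+1) : [/\ 0 <= sg i, sg i <= sg i.+1 & sg i.+1 <= 2^-1].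
  by split; [exact: sg_ge0|exact: sg_homo|exact: sg_half].
have [[su le]|h] := pselect (saturated p q u /\ lo_of a p q u <= hi_of a p q u).
  rewrite Epq_weightE//.
  transitivity (\sum_(i < n.+1)
    ((clip a p q u (sg i.+1) - clip a p q u (sg i))
     - (clip a p q u (1 - sg i.+1) - clip a p q u (1 - sg i)))).
    rewrite sumrB (telescope_ord (fun i => clip a p q u (sg i))).
    rewrite (telescope_ord (fun i => clip a p q u (1 - sg i))).
    rewrite sgN ?alpha_extN// sg0// subr0.
    have -> : 1 - 2^-1 = 2^-1 :> R by lra.
    have l0 := lo_of_ge0 a p q u; have h1 := hi_of_le1 a p q u.
    have -> : clip a p q u 0 = lo_of a p q u by rewrite /clip max_r// min_l.
    have -> : clip a p q u 1 = hi_of a p q u.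
      by rewrite /clip max_l ?min_r//; exact: le_trans h1.
    by ring.
  apply: eq_bigr => i _; have [s0 s1 s2] := sgi i.
  have iN : (i <= n)%N by rewrite -ltnS.
  rewrite (clip_diff su (@saturated_ujoin _ p q i) le s0 s1 _ (separates_left iN)); last by lra.
  rewrite opprB.
  rewrite (clip_diff su (@saturated_ujoinC _ p q i) le _ _ _ (separates_right iN)); try lra.
(* Each u_i and u'_i is saturated with lo <= hi, so [u] is none of them and both sides vanish. *)
rewrite Epq_weight0// big1// => i _; have [s0 s1 s2] := sgi i.
have iN : (i <= n)%N by rewrite -ltnS.
have [e|_] := eqVneq (ujoin i p q) u; last have [e|_] := eqVneq (ujoin i q p) u.
- case: h; rewrite -e; split; first exact: saturated_ujoin.
  have [] := separates_in s0 _ (separates_left iN); lra.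
- case: h; rewrite -e; split; first exact: saturated_ujoinC.
  have [] := separates_in _ _ (separates_right iN); lra.
- by rewrite addr0 mulr0.
Qed.

End EdgeWeights.

(** * Infinite values *)

(** No summand is -oo, so nothing can compensate a +oo and the finite bound forces every term to be
    finite. The convention 0 * oo = 0 accounts for the omitted terms. *)
Lemma weighted_fin_le (R : realType) (I : finType) (c : I -> R) (F : I -> \bar R)
    (x y : \bar R) :
  (forall i, 0 <= c i) -> (forall i, F i != -oo%E) -> x != -oo%E ->
  y \is a fin_num ->
  (x + \sum_i (c i)%:E * F i <= y)%E <->
  [/\ x \is a fin_num, forall i, 0 < c i -> F i \is a fin_num &
      fine x + \sum_i c i * fine (F i) <= fine y].
Proof.
move=> c0 FN xN yfin.
have tE i : (0 < c i -> F i \is a fin_num) -> ((c i)%:E * F i = (c i * fine (F i))%:E)%E.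
  move=> h; have [/h Fi|] := boolP (0 < c i); first by rewrite EFinM fineK.
  by rewrite lt_neqAle c0 andbT negbK => /eqP <-; rewrite mul0e mul0r.
have sumE : (forall i, 0 < c i -> F i \is a fin_num) ->
    (\sum_i (c i)%:E * F i = (\sum_i c i * fine (F i))%:E)%E.
  by move=> h; rewrite -sumEFin; apply: eq_bigr => i _; rewrite tE//; exact: h.
split; last first.
  move=> [xfin Ffin]; rewrite sumE// -{2}(fineK xfin) -{2}(fineK yfin) -EFinD lee_fin.
  by [].
move=> le.
have tN i : ((c i)%:E * F i != -oo)%E.
  have := FN i; case: (F i) => [r _ //|_|//].
  have := c0 i; rewrite le_eqVlt => /orP[/eqP<-|ci]; first by rewrite mul0e.
  by rewrite gt0_muley// lte_fin.
have sN (P : pred I) : (\sum_(i | P i) (c i)%:E * F i != -oo)%E.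
  apply: (big_ind (fun z : \bar R => z != -oo%E)) => // s t sN tN'.
  by rewrite adde_eq_ninfty negb_or sN.
have not_y (s t : \bar R) : s != -oo%E -> t != -oo%E -> (s + t <= y)%E ->
    s \is a fin_num /\ t \is a fin_num.
  by clear le; case: y yfin => // r _; case: s => [s| |]; case: t => [t| |].
have [xfin sfin] := not_y _ _ xN (sN xpredT) le.
have Ffin i : 0 < c i -> F i \is a fin_num.
  move=> ci; move: sfin; rewrite (bigD1 i)//= fin_numD => /andP[+ _].
  have := FN i; case: (F i) => [r _ //|_|//].
  by rewrite gt0_muley// lte_fin.
split=> //; move: le; rewrite sumE// -{1}(fineK xfin) -{1}(fineK yfin) -EFinD lee_fin.
by [].
Qed.

Section Translation.
Variables (R : realType) (n : nat) (a : 'I_n -> R).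
Hypothesis a_pos : forall j, 0 < a j.
Hypothesis a_mono : forall j k : 'I_n, (j <= k)%N -> a j <= a k.
Hypothesis a_le1 : forall j, a j <= 1.
Variable f : S2n n -> \bar R.
Hypothesis f_fin : forall p, f p != -oo%E.

Let D : pred (S2n n) := fun p => f p \is a fin_num.
Let g p := fine (f p).
Local Notation al := (alpha_ext a).

Lemma pair_le (x : \bar R) p q :
  (D p -> D q -> x <= f p + f q)%E -> (x <= f p + f q)%E.
Proof.
move=> h; have := f_fin p; have := f_fin q; move: h; rewrite /D.
by case: (f p) => [r| |]; case: (f q) => [s| |] // h _ _;
  by [apply: h|rewrite leey].
Qed.

Lemma alpha_bisubmodularE : alpha_bisubmodular a f <-> bisub_on al D g.
Proof.
have st := alpha_ext_step a_pos a_mono a_le1.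
have c0 (i : 'I_n.+1) : 0 <= al i.+1 - al i by rewrite subr_ge0 st.
split=> H p q.
  move=> Dp Dq; have Dpq : (f p + f q)%E \is a fin_num by rewrite fin_numD; apply/andP.
  have /(weighted_fin_le c0 (fun i => f_fin (sjoin_i i p q)) (f_fin _) Dpq)[] := H p q.
  by rewrite fineD.
apply: pair_le => Dp Dq; have Dpq : (f p + f q)%E \is a fin_num by rewrite fin_numD; apply/andP.
have [h1 h2 h3] := H p q Dp Dq.
apply/(weighted_fin_le c0 (fun i => f_fin (sjoin_i i p q)) (f_fin _) Dpq).
by rewrite fineD.
Qed.

Lemma submodular_wrtE : submodular_wrt a f <-> sub_on al D g.
Proof.
have st := alpha_ext_step a_pos a_mono a_le1.
have cc0 (i : 'I_n.+1) : 0 <= sigma_of (al i.+1) - sigma_of (al i).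
  by rewrite subr_ge0 (sg_homo a_pos a_mono a_le1).
have w0 p q u : 0 <= Epq_weight a p q u.
  rewrite (Epq_weight_sum a_pos a_mono a_le1) sumr_ge0// => i _.
  by rewrite mulr_ge0// addr_ge0.
have EqE p q : (\sum_(u | `[< Epq a p q u >]) (cone_measure (Cone a u p q))%:E * f u
    = \sum_u (Epq_weight a p q u)%:E * f u)%E.
  rewrite [LHS]big_mkcond; apply: eq_bigr => u _; rewrite /Epq_weight.
  by case: ifP => // _; rewrite mul0e.
have sumE p q : \sum_u Epq_weight a p q u * g u = \sum_(i < n.+1)
    (sigma_of (al i.+1) - sigma_of (al i)) * (g (ujoin i p q) + g (ujoin i q p)).
  have pick v : \sum_u (v == u)%:R * g u = g v.
    rewrite (bigD1 v)//= eqxx mul1r big1 ?addr0// => u.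
    by rewrite eq_sym => /negPf ->; rewrite mul0r.
  under eq_bigr do rewrite (Epq_weight_sum a_pos a_mono a_le1) mulr_suml.
  rewrite exchange_big/=; apply: eq_bigr => i _.
  under eq_bigr do rewrite -mulrA [X in _ * X]mulrDl.
  by rewrite -mulr_sumr big_split/= !pick.
have wgt (p q : S2n n) (i : 'I_n.+1) : 0 < sigma_of (al i.+1) - sigma_of (al i) ->
    0 < Epq_weight a p q (ujoin i p q).
  move=> ci; rewrite (Epq_weight_sum a_pos a_mono a_le1) (bigD1 i)//= eqxx.
  apply: ltr_pwDl; first by apply: mulr_gt0 => //; rewrite ltr_pwDl.
  by apply: sumr_ge0 => k _; apply: mulr_ge0; [exact: cc0|rewrite addr_ge0].
split=> H p q.
  move=> Dp Dq; have Dpq : (f p + f q)%E \is a fin_num by rewrite fin_numD; apply/andP.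
  have := H p q; rewrite EqE => /(weighted_fin_le (w0 p q) f_fin (f_fin _) Dpq)[].
  rewrite fineD// sumE => h1 h2 h3; split => // i ci; exact/h2/wgt.
apply: pair_le => Dp Dq; have Dpq : (f p + f q)%E \is a fin_num by rewrite fin_numD; apply/andP.
(* The domain clause of [sub_on] covers the u_i; the swapped pair supplies the u'_i. *)
have [h1 h2 h3] := H p q Dp Dq; have [_ h2' _] := H q p Dq Dp.
rewrite EqE; apply/(weighted_fin_le (w0 p q) f_fin (f_fin _) Dpq).
rewrite fineD// sumE; split => // u.
rewrite lt_neqAle w0 andbT eq_sym => ne.
apply: contraNT ne => nD; apply/eqP.
rewrite (Epq_weight_sum a_pos a_mono a_le1) big1// => i _.
have := cc0 i; rewrite le_eqVlt => /orP[/eqP<-|ci]; first by rewrite mul0r.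
have [e|_] := eqVneq (ujoin i p q) u; first by case/negP: nD; rewrite -e; exact: h2.
have [e|_] := eqVneq (ujoin i q p) u; first by case/negP: nD; rewrite -e; exact: h2'.
by rewrite addr0 mulr0.
Qed.

End Translation.

Theorem theorem3p14 (R : realType) (n : nat) (a : 'I_n -> R)
  (a_pos : forall j : 'I_n, 0 < a j)
  (a_mono : forall j k : 'I_n, (j <= k)%N -> a j <= a k)
  (a_le1 : forall j : 'I_n, a j <= 1)
  (f : S2n n -> \bar R) (f_fin : forall p : S2n n, f p != -oo%E) :
  alpha_bisubmodular a f <-> submodular_wrt a f.
Proof.
have st := alpha_ext_step a_pos a_mono a_le1.
rewrite (alpha_bisubmodularE a_pos a_mono a_le1 f_fin).
rewrite (submodular_wrtE a_pos a_mono a_le1 f_fin).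
have al1 := alpha_ext1_gt0 a_pos.
split; [apply: bisub_sub|apply: sub_bisub] => //; exact: alpha_extN.
Qed.
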